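(* Let $k$ be a field, $n\ge2$, $m_1,\ldots,m_n\ge2$ integers, and $q=\{q_{ij}\}_{1\le i<j\le n}$ elements of $k^\times$ that freely generate a free abelian subgroup of $k^\times$. Let \[\Lambda_q(m_1,\ldots,m_n)=k\langle x_1,\ldots,x_n\rangle/\big(x_i^{m_i}\ (1\le i\le n),\ x_jx_i-q_{ij}x_ix_j\ (i<j)\big).\] Then as an algebra \[ \mathrm{HH}^*(\Lambda_q(m_1,\ldots,m_n))\cong k[U]/(U^2)\times_k{\textstyle\bigwedge^*_k}(V_1,\ldots,V_n), \] with $U$ in cohomological degree $0$ and each $V_i$ in degree $1$, and the Gerstenhaber bracket is given by $[V_i,U]=(m_i-1)U$ and $[V_i,V_j]=0$ for all $i,j$.
   Context: $\mathrm{HH}^*$ denotes Hochschild cohomology $\mathrm{HH}^*(\Lambda,\Lambda)$ with its cup product and Gerstenhaber bracket. The fiber product $k[U]/(U^2)\times_k\bigwedge^*_k(V_1,\ldots,V_n)$ is the fiber product over $k$ with respect to the augmentations sending $U$ and all $V_i$ to $0$; thus $U\cdot V_i=0$ for all $i$, $U^2=0$, and the $V_i$ generate an exterior algebra. *)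

(* Defs.v *)
From HB Require Import structures.
From mathcomp Require Import all_boot all_order all_algebra.
Set Implicit Arguments. Unset Strict Implicit. Unset Printing Implicit Defensive.
Import Order.TTheory GRing.Theory Num.Theory.
Local Open Scope ring_scope.

Section Presentation.
Variables (k : fieldType) (n : nat) (m : 'I_n -> nat) (q : 'I_n -> 'I_n -> k).

Definition qci_relations (B : algType k) (y : 'I_n -> B) : Prop :=
  (forall i, y i ^+ m i = 0) /\
  (forall i j : 'I_n, (i < j)%N -> y j * y i = q i j *: (y i * y j)).

Definition alg_generated (A : algType k) (x : 'I_n -> A) : Prop :=
  forall S : A -> Prop, S 1 -> (forall i, S (x i)) ->
    (forall a b, S a -> S b -> S (a + b)) ->
    (forall a b, S a -> S b -> S (a * b)) ->
    (forall (c : k) a, S a -> S (c *: a)) -> forall a, S a.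

(* (A, x) is the algebra k<x_1..x_n>/(relations): generated by x, x satisfies
   the relations, and any family satisfying the relations in any k-algebra
   is the image of x under a k-algebra morphism (universal property). *)
Definition is_qci_presentation (A : algType k) (x : 'I_n -> A) : Prop :=
  [/\ qci_relations x, alg_generated x &
      forall (B : algType k) (y : 'I_n -> B), qci_relations y ->
        exists f : A -> B, [/\ linear f, monoid_morphism f &
                               forall i, f (x i) = y i]].
End Presentation.

Definition free_abelian_gens (k : fieldType) (n : nat) (q : 'I_n -> 'I_n -> k) :=
  (forall i j : 'I_n, (i < j)%N -> q i j != 0) /\
  (forall e : 'I_n -> 'I_n -> int,
     \prod_(i < n) \prod_(j < n | (i < j)%N) q i j ^ (e i j) = 1 ->
     forall i j : 'I_n, (i < j)%N -> e i j = 0).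

(* Hochschild cochain complex C^p(A,A): a p-cochain is a function seq A -> A,
   only its values on lists of length p matter, required k-multilinear. *)
Section Hochschild.
Variables (k : fieldType) (A : algType k).

Definition multilinear (p : nat) (f : seq A -> A) : Prop :=
  forall (s t : seq A) (a b : A) (c : k), (size s + size t).+1 = p ->
    f (s ++ (c *: a + b) :: t) = c *: f (s ++ a :: t) + f (s ++ b :: t).

Definition merge_at (s : seq A) (i : nat) : seq A :=
  take i.-1 s ++ (nth 0 s i.-1 * nth 0 s i) :: drop i.+1 s.

Definition hdiff (f : seq A -> A) (s : seq A) : A :=
  head 0 s * f (behead s)
  + \sum_(1 <= i < size s) (-1) ^+ i * f (merge_at s i)
  + (-1) ^+ (size s) * (f (take (size s).-1 s) * last 0 s).

Definition cocycle (p : nat) (f : seq A -> A) : Prop :=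
  multilinear p f /\ forall s, size s = p.+1 -> hdiff f s = 0.

Definition cohomologous (p : nat) (f g : seq A -> A) : Prop :=
  match p with
  | 0 => f [::] = g [::]
  | p'.+1 => exists h, multilinear p' h /\
                 forall s, size s = p'.+1 -> f s - g s = hdiff h s
  end.

Definition cup (p : nat) (f g : seq A -> A) : seq A -> A :=
  fun s => f (take p s) * g (drop p s).

(* Gerstenhaber circle product of a p-cochain f and a q-cochain g:
   f o g = sum_{i=1}^p (-1)^((i-1)(q-1)) f o_i g *)
Definition gcirc (p q : nat) (f g : seq A -> A) : seq A -> A :=
  fun s => \sum_(i < p) (-1) ^+ (i * q.+1) *
     f (take i s ++ g (take q (drop i s)) :: drop (i + q) s).

(* Gerstenhaber bracket [f,g] = f o g - (-1)^((p-1)(q-1)) g o f *)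
Definition gbracket (p q : nat) (f g : seq A -> A) : seq A -> A :=
  fun s => gcirc p q f g s - (-1) ^+ (p.+1 * q.+1) * gcirc q p g f s.

Definition cst1 : seq A -> A := fun _ => 1.
Definition czero : seq A -> A := fun _ => 0.

End Hochschild.

Section Generators.
Variables (k : fieldType) (A : algType k) (n : nat).

Definition vprod (v : 'I_n -> seq A -> A) (l : seq 'I_n) : seq A -> A :=
  foldr (fun i acc => cup 1 (v i) acc) (@cst1 k A) l.

(* general element of degree p of the proposed algebra, on the basis
   {1, U} (p = 0) and {V_S = V_{s_1}...V_{s_p} : S = {s_1<...<s_p}} *)
Definition hh_combo (u : seq A -> A) (v : 'I_n -> seq A -> A) (p : nat)
  (c : {set 'I_n} -> k) (b : k) : seq A -> A :=
  fun s => \sum_(S : {set 'I_n} | #|S| == p) c S *: vprod v (enum S) s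
           + (if p == 0%N then b *: u s else 0).

End Generators.

(* Main.v *)
Require Import Defs.
From HB Require Import structures.
From mathcomp Require Import all_boot all_order all_algebra zify ring.
Set Implicit Arguments. Unset Strict Implicit. Unset Printing Implicit Defensive.
Import Order.TTheory GRing.Theory Num.Theory.
Local Open Scope ring_scope.

(** Each multidegree of the Hochschild complex of A is, after division by
    products of the q_ij, the bar complex of the commutative algebra
    R = k[x_1..x_n]/(x_i^(m_i)) with coefficients in R, the left action being
    twisted by a character lambda.  Cochains of R with values in any bimodule
    are compared with the complex K built from the tensor product of the
    2-periodic resolutions of the k[x_i]/(x_i^(m_i)); the comparison is
    injective on cohomology by dimension shifting, since K is exact on
    coinduced bimodules.  In direction i the differentials of K are, on R twisted
    by lambda, shifts multiplied by lambda_i - 1 and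
    1 + lambda_i + ... + lambda_i^(m_i - 1).  Freeness of the q_ij makes both
    invertible in some usable direction for every multidegree other than 0,
    where K is the exterior algebra on the V_i, and the multidegree of
    U = prod x_i^(m_i - 1), where only degree 0 contributes. *)

(** * Exponents and bimodules *)

(** The comparison [phi] is only shown to be injective on cohomology. This bounds HH from above;
    independence of the products V_S comes from coordinates of [phi] that vanish on coboundaries and
    are dual to the V_S. Only twisted copies of R matter in the end, but dimension shifting replaces
    a bimodule V by [coker V], so [phi] and K are set up for arbitrary bimodules and every induction
    on the degree is generalized over V. The scalar lambda_i of a multidegree w arises from moving
    x_i past x^w: it is a product of powers q_ij^(w_j) or q_ji^(-w_j) over j different from i. It
    has infinite order once some such w_j is nonzero, and it does not see w_i; two directions are
    therefore needed. Direction i is usable when moreover w_i differs from m_i - 1: x_i kills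
    x_i^(m_i - 1), so in degree 0 of direction i the shift cannot be inverted on that power. *)

Section Signs.
Variable V : zmodType.
Definition signed (b : bool) (v : V) := if b then - v else v.
Lemma signed_is_additive b : zmod_morphism (signed b).
Proof. by case: b => u v //=; rewrite /signed opprB opprK addrC. Qed.
HB.instance Definition _ b := GRing.isZmodMorphism.Build V V (signed b) (signed_is_additive b).
Lemma signedK b : involutive (signed b).
Proof. by case: b => v //=; rewrite /signed opprK. Qed.
End Signs.

Lemma raddf_signed (U V : zmodType) (f : {additive U -> V}) b v : f (signed b v) = signed b (f v).
Proof. by case: b; rewrite /signed ?raddfN. Qed.

Lemma subrACA (V : zmodType) (a b c d : V) : (a - b) - (c - d) = (a - c) - (b - d).
Proof. by rewrite !opprB addrACA [RHS]addrACA [- c - b]addrC. Qed.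

(** The diagonal is assumed zero separately because antisymmetry alone gives only 2 F i i = 0. *)
Lemma sum_antisym (V : zmodType) (I : finType) (F : I -> I -> V) :
  (forall i, F i i = 0) -> (forall i j, i != j -> F i j = - F j i) ->
  \sum_i \sum_j F i j = 0.
Proof.
move=> F0 FN; rewrite pair_big /=.
pose lt (u : I * I) := (enum_rank u.1 < enum_rank u.2)%N.
rewrite (bigID (fun u => u.1 == u.2)) /= big1 ?add0r; last first.
  by case=> i j /= /eqP ->.
rewrite (bigID lt) /=.
rewrite [X in _ + X](reindex_inj (h := fun u : I * I => (u.2, u.1))) /=; last first.
  by case=> i j [i' j'] /= [-> ->].
rewrite [X in _ + X](eq_bigl (fun u => (u.1 != u.2) && lt u)); last first.
  case=> i j; rewrite /lt /= eq_sym; case: eqVneq => //= ne.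
  by rewrite -leqNgt leq_eqVlt; case: eqP => // /val_inj /enum_rank_inj e; rewrite e eqxx in ne.
by rewrite -big_split big1 //= => -[i j] /= /andP[ne _]; rewrite FN // addNr.
Qed.

Section Exponents.
Variables (n : nat) (m : 'I_n -> nat).

Definition expo := {ffun 'I_n -> nat}.
Definition box (c : expo) := [forall i, c i < m i]%N.
Definition cell := {dffun forall i : 'I_n, 'I_(m i)}.
Definition cexp (t : cell) : expo := [ffun i => nat_of_ord (t i)].
Definition unit_at (i : 'I_n) (t : nat) : expo := [ffun j => if j == i then t else 0%N].
Definition set_at (c : expo) (i : 'I_n) (t : nat) : expo :=
  [ffun j => if j == i then t else c j].

Lemma addEE (c c' : expo) i : (c + c') i = (c i + c' i)%N.
Proof. by rewrite ffunE. Qed.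
Lemma zeroEE i : (0 : expo) i = 0%N.
Proof. by rewrite ffunE. Qed.

Lemma unit_atE i t j : unit_at i t j = if j == i then t else 0%N.
Proof. by rewrite ffunE. Qed.
Lemma set_atE (c : expo) i t j : set_at c i t j = if j == i then t else c j.
Proof. by rewrite ffunE. Qed.

Lemma unit_atD i s t : unit_at i (s + t) = unit_at i s + unit_at i t.
Proof. by apply/ffunP=> j; rewrite addEE !unit_atE; case: eqP. Qed.
Lemma unit_at0 i : unit_at i 0 = 0.
Proof. by apply/ffunP=> j; rewrite unit_atE zeroEE; case: eqP. Qed.

Lemma boxP (c : expo) : reflect (forall i, (c i < m i)%N) (box c).
Proof. exact: forallP. Qed.

Lemma box_addl (c c' : expo) : box (c + c') -> box c.
Proof.
move/boxP=> b; apply/boxP=> i; have := b i; rewrite addEE.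
by apply: leq_ltn_trans; rewrite leq_addr.
Qed.

Lemma box_addr (c c' : expo) : box (c + c') -> box c'.
Proof. by rewrite addrC; apply: box_addl. Qed.

Lemma box_cexp t : box (cexp t).
Proof. by apply/boxP=> i; rewrite ffunE. Qed.

Lemma cexp_inj : injective cexp.
Proof.
move=> s t /ffunP e; apply/ffunP=> i; apply: val_inj.
by have := e i; rewrite !ffunE.
Qed.

Lemma box_cell c : box c -> exists t, c = cexp t.
Proof.
move/boxP=> b; exists [ffun i => Ordinal (b i)].
by apply/ffunP=> i; rewrite !ffunE.
Qed.

(* The value of [F] at [c], or 0 if [c] lies outside the box. *)
Definition ext (V : zmodType) (c : expo) (F : {ffun cell -> V}) : V :=
  \sum_(t | cexp t == c) F t.

Lemma ext_is_additive (V : zmodType) c : zmod_morphism (@ext V c).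
Proof. by move=> F G; rewrite /ext -sumrB; apply: eq_bigr => t _; rewrite !ffunE. Qed.
HB.instance Definition _ (V : zmodType) (c : expo) :=
  GRing.isZmodMorphism.Build {ffun cell -> V} V (@ext V c) (@ext_is_additive V c).

Section ExtLinear.
Variables (V : zmodType) (c : expo).
Implicit Types F G : {ffun cell -> V}.
Lemma extB F G : ext c (F - G) = ext c F - ext c G.
Proof. exact: raddfB. Qed.
Lemma extD F G : ext c (F + G) = ext c F + ext c G.
Proof. exact: raddfD. Qed.
Lemma ext0 : ext c (0 : {ffun cell -> V}) = 0.
Proof. exact: raddf0. Qed.
Lemma ext_sum (I : Type) (r : seq I) (P : pred I) (E : I -> {ffun cell -> V}) :
  ext c (\sum_(i <- r | P i) E i) = \sum_(i <- r | P i) ext c (E i).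
Proof. exact: raddf_sum. Qed.
End ExtLinear.

Lemma ext_cexp (V : zmodType) (F : {ffun cell -> V}) t : ext (cexp t) F = F t.
Proof.
by rewrite /ext (big_pred1 t) // => u; rewrite (inj_eq cexp_inj).
Qed.

Lemma ext_out (V : zmodType) c (F : {ffun cell -> V}) : ~~ box c -> ext c F = 0.
Proof.
by move=> nb; rewrite /ext big1 // => t /eqP e; rewrite -e box_cexp in nb.
Qed.

Lemma ext_ffun (V : zmodType) (g : expo -> V) c :
  (forall c, ~~ box c -> g c = 0) -> ext c [ffun t => g (cexp t)] = g c.
Proof.
move=> g0; case: (boolP (box c)) => [/box_cell[t ->]|nb]; last by rewrite ext_out ?g0.
by rewrite ext_cexp ffunE.
Qed.

Lemma ext_inj (V : zmodType) (F G : {ffun cell -> V}) :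
  (forall c, box c -> ext c F = ext c G) -> F = G.
Proof.
by move=> e; apply/ffunP=> t; rewrite -!ext_cexp e ?box_cexp.
Qed.

Definition liftI (U V : zmodType) (h : U -> V) (F : {ffun cell -> U}) : {ffun cell -> V} :=
  [ffun t => h (F t)].

Lemma ext_liftI (U V : zmodType) (h : {additive U -> V}) c F :
  ext c (liftI h F) = h (ext c F).
Proof. by rewrite /ext raddf_sum; apply: eq_bigr => t _; rewrite ffunE. Qed.

Lemma liftI_is_additive (U V : zmodType) (h : {additive U -> V}) : zmod_morphism (liftI h).
Proof. by move=> F G; apply/ffunP=> t; rewrite !ffunE raddfB. Qed.
HB.instance Definition _ (U V : zmodType) (h : {additive U -> V}) :=
  GRing.isZmodMorphism.Build {ffun cell -> U} {ffun cell -> V} (liftI h) (liftI_is_additive h).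

Section Shift.
Variable V : zmodType.
Local Notation W := ({ffun cell -> V}).

Definition shiftI (c : expo) (F : W) : W := [ffun t => ext (cexp t + c) F].

Lemma ext_shiftI c u F : ext u (shiftI c F) = ext (u + c) F.
Proof.
rewrite (@ext_ffun _ (fun u => ext (u + c) F)) // => u' nb.
by rewrite ext_out //; apply: contra nb; apply: box_addl.
Qed.
Lemma shiftI_add c : zmod_morphism (shiftI c).
Proof. by move=> F G; apply: ext_inj => u _; rewrite extB !ext_shiftI extB. Qed.
Lemma shiftI0 F : shiftI 0 F = F.
Proof. by apply: ext_inj => u _; rewrite ext_shiftI addr0. Qed.
Lemma shiftID c c' F : shiftI (c + c') F = shiftI c (shiftI c' F).
Proof. by apply: ext_inj => u _; rewrite !ext_shiftI addrA. Qed.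
Lemma shiftI_out c F : ~~ box c -> shiftI c F = 0.
Proof.
move=> nb; apply: ext_inj => u _; rewrite ext_shiftI ext0 ext_out //.
by apply: contra nb; apply: box_addr.
Qed.
End Shift.

(* Bimodules over Z[x_1..x_n]/(x_i^(m_i)), given by the left and right actions
   of the monomials. *)
Record bimod := Bimod {
  car :> zmodType;
  lact : expo -> car -> car;
  ract : expo -> car -> car;
  lact_add : forall c, zmod_morphism (lact c);
  ract_add : forall c, zmod_morphism (ract c);
  lact0 : forall v, lact 0 v = v;
  ract0 : forall v, ract 0 v = v;
  lactD : forall c c' v, lact (c + c') v = lact c (lact c' v);
  ractD : forall c c' v, ract (c + c') v = ract c (ract c' v);
  lact_out : forall c v, ~~ box c -> lact c v = 0;
  ract_out : forall c v, ~~ box c -> ract c v = 0;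
  lractC : forall c c' v, lact c (ract c' v) = ract c' (lact c v) }.

HB.instance Definition _ (V : bimod) c :=
  GRing.isZmodMorphism.Build V V (@lact V c) (@lact_add V c).
HB.instance Definition _ (V : bimod) c :=
  GRing.isZmodMorphism.Build V V (@ract V c) (@ract_add V c).

(** * Coinduced bimodules and their quotients *)

Section Coinduced.
Variable V : bimod.
Local Notation W := ({ffun cell -> V}).

Definition actI (c : expo) (F : W) : W := liftI (@ract V c) F.

Lemma ext_actI c u F : ext u (actI c F) = ract c (ext u F).
Proof. exact: ext_liftI. Qed.

Definition extE := (ext_shiftI, ext_actI).

Lemma actI_add c : zmod_morphism (actI c).
Proof. exact: liftI_is_additive. Qed.
Lemma actI0 F : actI 0 F = F.
Proof. by apply: ext_inj => u _; rewrite extE ract0. Qed.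
Lemma actID c c' F : actI (c + c') F = actI c (actI c' F).
Proof. by apply: ext_inj => u _; rewrite !extE ractD. Qed.
Lemma actI_out c F : ~~ box c -> actI c F = 0.
Proof. by move=> nb; apply: ext_inj => u _; rewrite extE ext0 ract_out. Qed.
Lemma shift_actI c c' F : shiftI c (actI c' F) = actI c' (shiftI c F).
Proof. by apply: ext_inj => u _; rewrite !extE. Qed.

(** This is Hom(R, V): the left action precomposes with multiplication in R, the right action acts
    on values. *)
Definition coind : bimod :=
  Bimod (@shiftI_add V) actI_add (@shiftI0 V) actI0 (@shiftID V) actID
    (@shiftI_out V) actI_out shift_actI.

Definition iota (v : V) : coind := [ffun t => lact (cexp t) v].
Lemma ext_iota c v : ext c (iota v) = lact c v.
Proof. by apply: (@ext_ffun _ (fun c => lact c v)) => c' nb; rewrite lact_out. Qed.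

Lemma iota_is_additive : zmod_morphism iota.
Proof. by move=> u v; apply: ext_inj => c _; rewrite extB !ext_iota raddfB. Qed.
HB.instance Definition _ := GRing.isZmodMorphism.Build V coind iota iota_is_additive.

(* [coker] is the cokernel of [iota] (realised as the functions killed by
   [ext 0]) plus a summand on which the left action is the augmentation; the
   extra summand makes the carrier the same as that of [coind]. *)
Lemma addE_eq0 (c c' : expo) : (c + c' == 0) = (c == 0) && (c' == 0).
Proof.
apply/eqP/andP=> [/ffunP e|[/eqP -> /eqP ->]]; last by rewrite addr0.
by split; apply/eqP/ffunP=> i; move/eqP: (e i);
  rewrite addEE zeroEE addn_eq0 => /andP[/eqP ? /eqP ?].
Qed.

(** For c nonzero this is [proj] of the shift, that is, the action induced on the quotient by
    [iota]. The case c = 0 is separate because [proj] is not the identity on the extra summand. *)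
Definition shiftJ (c : expo) (F : W) : W :=
  if c == 0 then F else shiftI c F - iota (ext c F).

Lemma ext_shiftJ c u F : c != 0 ->
  ext u (shiftJ c F) = ext (u + c) F - lact u (ext c F).
Proof. by move=> c0; rewrite /shiftJ (negPf c0) extB extE ext_iota. Qed.

Lemma shiftJ0 F : shiftJ 0 F = F.
Proof. by rewrite /shiftJ eqxx. Qed.
Lemma shiftJ_add c : zmod_morphism (shiftJ c).
Proof.
move=> F G; case: (eqVneq c 0) => [->|c0]; first by rewrite !shiftJ0.
apply: ext_inj => u _; rewrite extB !ext_shiftJ // !extB raddfB /=.
exact: subrACA.
Qed.

Lemma shiftJD c c' F : shiftJ (c + c') F = shiftJ c (shiftJ c' F).
Proof.
case: (eqVneq c 0) => [->|c0]; first by rewrite add0r shiftJ0.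
case: (eqVneq c' 0) => [->|c'0]; first by rewrite addr0 shiftJ0.
apply: ext_inj => u _; rewrite ext_shiftJ; last by rewrite addE_eq0 (negPf c0).
rewrite !ext_shiftJ // addrA lactD [lact u (_ - _)]raddfB /=.
by rewrite opprB subrKA.
Qed.
Lemma shiftJ_out c F : (forall i, (0 < m i)%N) -> ~~ box c -> shiftJ c F = 0.
Proof.
move=> m0 nb; have c0: c != 0.
  by apply: contraNneq nb => ->; apply/boxP=> i; rewrite zeroEE.
apply: ext_inj => u _; rewrite ext_shiftJ // ext0.
rewrite [ext c F]ext_out // raddf0 subr0 ext_out //.
by apply: contra nb; apply: box_addr.
Qed.
Lemma shift_actJ c c' F : shiftJ c (actI c' F) = actI c' (shiftJ c F).
Proof.
case: (eqVneq c 0) => [->|c0]; first by rewrite !shiftJ0.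
by apply: ext_inj => u _; rewrite !(ext_shiftJ, extE) // raddfB /= lractC.
Qed.

Definition coker (m0 : forall i, (0 < m i)%N) : bimod :=
  Bimod shiftJ_add actI_add shiftJ0 actI0 shiftJD actID
    (fun c v => @shiftJ_out c v m0) actI_out shift_actJ.

Definition proj (F : W) : W := F - iota (ext 0 F).
Lemma proj_is_additive : zmod_morphism proj.
Proof. by move=> F G; rewrite /proj extB [iota (_ - _)]raddfB /= subrACA. Qed.
HB.instance Definition _ := GRing.isZmodMorphism.Build W W proj proj_is_additive.
Lemma ext_proj c F : ext c (proj F) = ext c F - lact c (ext 0 F).
Proof. by rewrite extB ext_iota. Qed.
End Coinduced.
End Exponents.

(** * The bar complex and the small complex *)

Section Bar.
Variables (n : nat) (m : 'I_n -> nat).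
Local Notation bimod := (@bimod n m).
Local Notation cell := (@cell n m).
Local Notation expo := (@expo n).

(* Minus the terms of the Hochschild differential other than the left action. *)
Fixpoint delta_tail (V : bimod) (f : seq cell -> V) (s : seq cell) : V :=
  match s with
  | [::] => 0
  | c :: s1 =>
    match s1 with
    | [::] => ract (cexp c) (f [::])
    | c' :: s2 => ext (cexp c + cexp c') [ffun u => f (u :: s2)]
                  - delta_tail (fun r => f (c :: r)) s1
    end
  end.

Arguments delta_tail : simpl never.
Lemma delta_tail1 (V : bimod) (f : seq cell -> V) c : delta_tail f [:: c] = ract (cexp c) (f
  [::]).
Proof. by []. Qed.
Lemma delta_tail2 (V : bimod) (f : seq cell -> V) c c' s :
  delta_tail f [:: c, c' & s] = ext (cexp c + cexp c') [ffun u => f (u :: s)]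
                           - delta_tail (fun r => f (c :: r)) (c' :: s).
Proof. by []. Qed.

Definition delta (V : bimod) (f : seq cell -> V) (s : seq cell) : V :=
  if s is c :: s1 then lact (cexp c) (f s1) - delta_tail f s else 0.

Definition lmor (V W : bimod) (h : V -> W) := forall c v, h (lact c v) = lact c (h v).
Definition rmor (V W : bimod) (h : V -> W) := forall c v, h (ract c v) = ract c (h v).

Lemma delta_tail_eq (V : bimod) (f g : seq cell -> V) s :
  (forall r, (size r).+1 = size s -> f r = g r) -> delta_tail f s = delta_tail g s.
Proof.
elim: s f g => [|c [|c' s] IH] f g e //; first by rewrite !delta_tail1 e.
rewrite !delta_tail2.
congr (_ - _).
  by congr (ext _ _); apply/ffunP=> u; rewrite !ffunE e.
by apply: IH => r er; apply: e; rewrite /= er.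
Qed.

Lemma delta_tail_nat (V W : bimod) (h : {additive V -> W}) f s :
  rmor h -> delta_tail (fun r => h (f r)) s = h (delta_tail f s).
Proof.
move=> hY; elim: s f => [|c [|c' s] IH] f; rewrite ?raddf0 ?delta_tail1 ?hY // !delta_tail2.
rewrite IH raddfB; congr (_ - _); rewrite -ext_liftI.
by congr (ext _ _); apply/ffunP=> u; rewrite !ffunE.
Qed.

Lemma delta_tailB (V : bimod) (f g : seq cell -> V) s :
  delta_tail (fun r => f r - g r) s = delta_tail f s - delta_tail g s.
Proof.
elim: s f g => [|c [|c' s] IH] f g; first by rewrite subr0.
  by rewrite !delta_tail1 raddfB.
rewrite !delta_tail2 IH subrACA -extB; congr (_ - _).
by congr (ext _ _); apply/ffunP=> u; rewrite !ffunE.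
Qed.

Lemma delta_eq (V : bimod) (f g : seq cell -> V) s :
  (forall r, (size r).+1 = size s -> f r = g r) -> delta f s = delta g s.
Proof. by case: s => [|c s] e //=; rewrite e // (delta_tail_eq e). Qed.

Lemma delta_nat (V W : bimod) (h : {additive V -> W}) f s :
  lmor h -> rmor h -> delta (fun r => h (f r)) s = h (delta f s).
Proof.
by case: s => [|c s] hX hY /=; rewrite ?raddf0 // delta_tail_nat // raddfB hX.
Qed.

Lemma deltaB (V : bimod) (f g : seq cell -> V) s :
  delta (fun r => f r - g r) s = delta f s - delta g s.
Proof. by case: s => [|c s]; rewrite /delta ?subr0 // delta_tailB raddfB subrACA. Qed.

(** Currying the first argument turns cochains of degree p + 1 in V into cochains of degree p in
    [coind V]. Inductions on the bar degree therefore change the bimodule. *)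
Definition lead (V : bimod) (f : seq cell -> V) (s : seq cell) : coind V :=
  [ffun u => f (u :: s)].

Lemma ext_rmor (V : bimod) c : rmor (V := coind V) (@ext n m V c).
Proof. by move=> c' v; rewrite /= ext_actI. Qed.

Lemma delta_tail_lead (V : bimod) (f : seq cell -> V) u c s :
  delta_tail f [:: u, c & s] = delta (lead f) (c :: s) u.
Proof.
rewrite -[RHS]ext_cexp /delta extB ext_shiftI delta_tail2.
congr (_ - _); rewrite -(@delta_tail_nat (coind V) V (@ext n m V (cexp u))); last exact: ext_rmor.
by apply: delta_tail_eq => r _; rewrite /= ext_cexp ffunE.
Qed.

(** The left action term of [delta] curries to [iota], all other terms to a differential of lower
    degree. This recursion drives [delta_delta], [phi_delta] and [phi_injective]. *)
Lemma lead_delta (V : bimod) (f : seq cell -> V) s :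
  s != [::] -> lead (delta f) s = iota (f s) - delta (lead f) s.
Proof.
case: s => // c s _; apply/ffunP=> u.
by rewrite [LHS]ffunE [RHS]ffunE [X in X + _]ffunE [X in _ + X]ffunE -delta_tail_lead.
Qed.

Lemma iota_lmor (V : bimod) : lmor (@iota n m V).
Proof. by move=> c v; apply: ext_inj => u _; rewrite /= extE !ext_iota lactD. Qed.
Lemma iota_rmor (V : bimod) : rmor (@iota n m V).
Proof. by move=> c v; apply: ext_inj => u _; rewrite /= extE !ext_iota lractC. Qed.

Lemma delta_delta (V : bimod) (f : seq cell -> V) s : delta (delta f) s = 0.
Proof.
elim: s V f => [|u [|c s] IH] V f //; first by rewrite /= delta_tail1 /= !raddf0 addr0.
rewrite {1}/delta delta_tail_lead.
case: s IH => [|c' s] IH; last first.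
  have -> : delta (lead (delta f)) [:: c, c' & s] =
            delta (fun r => iota (f r) - delta (lead f) r) [:: c, c' & s].
    by apply: delta_eq => -[|? ?] // _; apply: lead_delta.
  rewrite deltaB IH subr0 delta_nat; [|exact: iota_lmor|exact: iota_rmor].
  by rewrite [X in _ - X]ffunE subrr.
(* With one remaining argument [lead_delta] does not apply; here the curried coboundary is the
   function e |-> x^e v - v x^e with v = f [::]. *)
rewrite -[X in _ - X]ext_cexp /delta /= extB ext_shiftI ext_actI.
rewrite (@ext_ffun _ _ _ (fun e => lact e (f [::]) - ract e (f [::]))); last first.
  by move=> e ne; rewrite lact_out // ract_out // subr0.
rewrite ext_cexp ffunE delta_tail1 [lact _ (_ - _)]raddfB [ract _ (_ - ract _ _)]raddfB /=.
by rewrite lactD lractC [cexp u + _]addrC ractD [- (ract _ _ - _)]opprB subrKA subrr.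
Qed.

(** * The small complex K *)

Definition koszul_sign (i : 'I_n) (a : expo) := odd (\sum_(j < n | (j < i)%N) a j).
Definition pred_at (a : expo) (i : 'I_n) : expo := set_at a i (a i).-1.

(* The differentials of the minimal resolution of k[x]/(x^m) over its
   enveloping algebra: x - y and x^(m-1) + x^(m-2) y + ... + y^(m-1). *)
Definition step (V : bimod) (i : 'I_n) (b : bool) (v : V) : V :=
  if b then lact (unit_at i 1) v - ract (unit_at i 1) v
  else \sum_(t < m i) lact (unit_at i t) (ract (unit_at i (m i - t.+1)) v).

Arguments step : simpl never.

(** The parity tested is that of the target: an odd a_i receives x_i - y_i, an even positive one
    receives the norm sum. *)
Definition kdiff_dir (V : bimod) (i : 'I_n) (g : expo -> V) (a : expo) : V :=
  if a i == 0%N then 0 else signed (koszul_sign i a) (step i (odd (a i)) (g (pred_at a i))).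

Definition kdiff (V : bimod) (g : expo -> V) (a : expo) : V := \sum_i kdiff_dir i g a.

Lemma step_is_additive V i b : zmod_morphism (@step V i b).
Proof.
case: b => u v; rewrite /step; first by rewrite [lact _ _]raddfB [ract _ _]raddfB /= subrACA.
by rewrite -sumrB; apply: eq_bigr => t _; rewrite !raddfB.
Qed.
HB.instance Definition _ (V : bimod) i b :=
  GRing.isZmodMorphism.Build V V (@step V i b) (@step_is_additive V i b).

Lemma step_nat (V W : bimod) (h : {additive V -> W}) i b v :
  lmor h -> rmor h -> step i b (h v) = h (step i b v).
Proof.
move=> hX hY; case: b; rewrite /step; first by rewrite raddfB /= hX hY.
by rewrite raddf_sum; apply: eq_bigr => t _; rewrite hX hY.
Qed.

Lemma lact_comm (V : bimod) c c' (v : V) : lact c (lact c' v) = lact c' (lact c v).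
Proof. by rewrite -!lactD addrC. Qed.
Lemma ract_comm (V : bimod) c c' (v : V) : ract c (ract c' v) = ract c' (ract c v).
Proof. by rewrite -!ractD addrC. Qed.

Lemma step_lmor (V : bimod) i b : lmor (@step V i b).
Proof.
move=> c v; rewrite -[RHS](@step_nat V V) //.
  by move=> c' u; apply: lact_comm.
by move=> c' u; apply: lractC.
Qed.
Lemma step_rmor (V : bimod) i b : rmor (@step V i b).
Proof.
move=> c v; rewrite -[RHS](@step_nat V V) //.
  by move=> c' u; rewrite /= lractC.
by move=> c' u; apply: ract_comm.
Qed.

Lemma step_comm (V : bimod) i b j b' (v : V) : step i b (step j b' v) = step j b' (step i b v).
Proof. by apply: step_nat; [exact: step_lmor|exact: step_rmor]. Qed.

Lemma unit_out i t : (m i <= t)%N -> ~~ box m (unit_at i t).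
Proof. by move=> le; apply/boxP=> /(_ i); rewrite unit_atE eqxx ltnNge le. Qed.

(** The product of x - y with the norm sum telescopes to x^m - y^m, and both powers lie outside the
    box. *)
Lemma step_sq (V : bimod) i b (v : V) : (0 < m i)%N -> step i b (step i (~~ b) v) = 0.
Proof.
move=> m0; wlog -> : b / b = true.
  by case: b => H; [apply: H | rewrite step_comm; apply: (H true)].
pose w t := lact (unit_at i t) (ract (unit_at i (m i - t)) v).
rewrite /step /= [lact _ _]raddf_sum [ract _ (\sum_(_ < _) _)]raddf_sum -sumrB /=.
rewrite (eq_bigr (fun t : 'I_(m i) => w t.+1 - w t)); last first.
  move=> t _ /=; rewrite -lactD -unit_atD add1n -lractC -ractD -unit_atD.
  by congr (_ - _); rewrite /w add1n subnSK.
rewrite -(big_mkord xpredT (fun t => w t.+1 - w t)) telescope_sumr // /w.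
by rewrite lact_out ?unit_out // subn0 ract_out ?unit_out // raddf0 subr0.
Qed.

Lemma pred_atE (a : expo) i j : pred_at a i j = if j == i then (a i).-1 else a j.
Proof. exact: set_atE. Qed.

Lemma pred_atC (a : expo) i j : pred_at (pred_at a i) j = pred_at (pred_at a j) i.
Proof.
case: (eqVneq i j) => [->//|ij]; apply/ffunP=> l; rewrite !pred_atE.
rewrite [j == i]eq_sym (negPf ij); case: (eqVneq l j) => [->|//].
by rewrite eq_sym (negPf ij).
Qed.

Lemma koszul_sign_pred (a : expo) i j : a j != 0%N -> koszul_sign i (pred_at a j) = (j < i)%N
  (+) koszul_sign i a.
Proof.
move=> aj; rewrite /koszul_sign; case: (boolP (j < i)%N) => ji.
  rewrite !(bigD1 j ji) /= pred_atE eqxx !oddD.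
  rewrite (eq_bigr a); last by move=> l /andP[_ /negPf lj]; rewrite pred_atE lj.
  by case: (a j) aj => //= b _; rewrite -addNb negbK.
congr odd; apply: eq_bigr => l li; rewrite pred_atE; case: eqP => // e.
by rewrite -e li in ji.
Qed.

Lemma kdiff_dir_anti (V : bimod) i j (g : expo -> V) a :
  i != j -> kdiff_dir i (kdiff_dir j g) a = - kdiff_dir j (kdiff_dir i g) a.
Proof.
move=> ij; rewrite /kdiff_dir !pred_atE [j == i]eq_sym (negPf ij).
case: eqP => ai; case: eqP => aj; rewrite ?raddf0 ?oppr0 //.
move/eqP: ai => ai; move/eqP: aj => aj.
rewrite [step i _ _]raddf_signed [step j _ (signed _ _)]raddf_signed /= step_comm
  !koszul_sign_pred // pred_atC.
have : (j < i)%N = ~~ (i < j)%N by rewrite -leqNgt ltn_neqAle val_eqE eq_sym ij.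
move=> ->; set v := step _ _ (step _ _ _).
by case: (i < j)%N; case: koszul_sign; case: koszul_sign; rewrite /signed /= ?opprK.
Qed.

Lemma kdiff_dir_sq (V : bimod) (m0 : forall i, (0 < m i)%N) i (g : expo -> V) a :
  kdiff_dir i (kdiff_dir i g) a = 0.
Proof.
rewrite /kdiff_dir !pred_atE eqxx; case ai: (a i) => [|[|b]] //=; first by rewrite !raddf0.
by rewrite [step _ _ (signed _ _)]raddf_signed /= step_comm step_sq // !raddf0.
Qed.

Lemma kdiff_dir_sum (V : bimod) (I : Type) (r : seq I) (P : pred I) i (G : I -> expo -> V) a :
  kdiff_dir i (fun b => \sum_(j <- r | P j) G j b) a = \sum_(j <- r | P j) kdiff_dir i (G j) a.
Proof.
rewrite /kdiff_dir; case: eqP => _; first by rewrite big1_eq.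
by rewrite !raddf_sum.
Qed.

Lemma kdiff_sq (V : bimod) (m0 : forall i, (0 < m i)%N) (g : expo -> V) a : kdiff (kdiff g) a = 0.
Proof.
rewrite /kdiff -[RHS](sum_antisym (F := fun i j => kdiff_dir i (kdiff_dir j g) a)).
- by apply: eq_bigr => i _; rewrite kdiff_dir_sum.
- by move=> i; apply: kdiff_dir_sq.
by move=> i j; apply: kdiff_dir_anti.
Qed.

Lemma kdiff_dir_eq (V : bimod) i (g h : expo -> V) a :
  (forall b, g b = h b) -> kdiff_dir i g a = kdiff_dir i h a.
Proof. by move=> e; rewrite /kdiff_dir e. Qed.
Lemma kdiff_eq (V : bimod) (g h : expo -> V) a : (forall b, g b = h b) -> kdiff g a = kdiff h a.
Proof. by move=> e; apply: eq_bigr => i _; apply: kdiff_dir_eq. Qed.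
Lemma kdiff_dirB (V : bimod) i (g h : expo -> V) a :
  kdiff_dir i (fun b => g b - h b) a = kdiff_dir i g a - kdiff_dir i h a.
Proof. by rewrite /kdiff_dir; case: eqP => _; rewrite ?subr0 // !raddfB. Qed.
Lemma kdiffB (V : bimod) (g h : expo -> V) a : kdiff (fun b => g b - h b) a = kdiff g a - kdiff
  h a.
Proof. by rewrite /kdiff -sumrB; apply: eq_bigr => i _; rewrite kdiff_dirB. Qed.
Lemma kdiffD (V : bimod) (g h : expo -> V) a : kdiff (fun b => g b + h b) a = kdiff g a + kdiff
  h a.
Proof.
rewrite /kdiff -big_split; apply: eq_bigr => i _ /=.
by rewrite /kdiff_dir; case: eqP => _; rewrite ?addr0 // !raddfD.
Qed.
Lemma kdiff_dir_nat (V W : bimod) (h : {additive V -> W}) i g a :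
  lmor h -> rmor h -> kdiff_dir i (fun b => h (g b)) a = h (kdiff_dir i g a).
Proof.
by move=> hX hY; rewrite /kdiff_dir; case: eqP => _; rewrite ?raddf0 // step_nat // raddf_signed.
Qed.
Lemma kdiff_nat (V W : bimod) (h : {additive V -> W}) g a :
  lmor h -> rmor h -> kdiff (fun b => h (g b)) a = h (kdiff g a).
Proof.
by move=> hX hY; rewrite /kdiff raddf_sum; apply: eq_bigr => i _; rewrite kdiff_dir_nat.
Qed.
Lemma kdiff0 (V : bimod) (g : expo -> V) : kdiff g 0 = 0.
Proof. by rewrite /kdiff big1 // => i _; rewrite /kdiff_dir zeroEE. Qed.

(* Dual to the chain map e |-> s (phi (d e)), where s is the standard
   contraction of the bar resolution. *)
Fixpoint phi (p : nat) : forall V : bimod, (seq cell -> V) -> expo -> V :=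
  match p with
  | 0 => fun V f a => if a == 0 then f [::] else 0
  | p'.+1 => fun V f a => ext 0 (kdiff (phi p' (lead f)) a)
  end.

Lemma phiS p (V : bimod) (f : seq cell -> V) a :
  phi p.+1 f a = ext 0 (kdiff (phi p (lead f)) a).
Proof. by []. Qed.
Lemma phi0 (V : bimod) (f : seq cell -> V) a : phi 0 f a = if a == 0 then f [::] else 0.
Proof. by []. Qed.
Arguments phi : simpl never.

Lemma phi_eq p (V : bimod) (f g : seq cell -> V) a :
  (forall s, size s = p -> f s = g s) -> phi p f a = phi p g a.
Proof.
elim: p V f g a => [|p IH] V f g a e; first by rewrite !phi0 e.
rewrite !phiS.
congr (ext 0 _); apply: (@kdiff_eq (coind _)) => b; apply: IH => s es; apply/ffunP=> u.
by rewrite !ffunE e // /= es.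
Qed.

Lemma liftI_lmor (V W : bimod) (h : {additive V -> W}) :
  lmor (V := coind V) (W := coind W) (liftI h).
Proof. by move=> c v; apply: ext_inj => u _; rewrite /= !(ext_liftI, extE). Qed.
Lemma liftI_rmor (V W : bimod) (h : {additive V -> W}) :
  rmor h -> rmor (V := coind V) (W := coind W) (liftI h).
Proof. by move=> hY c v; apply: ext_inj => u _; rewrite /= !(ext_liftI, extE) hY. Qed.

Lemma phi_nat p (V W : bimod) (h : {additive V -> W}) f a :
  rmor h -> phi p (fun s => h (f s)) a = h (phi p f a).
Proof.
elim: p V W h f a => [|p IH] V W h f a hY; rewrite ?phi0 ?phiS.
  by case: eqP => _; rewrite ?raddf0.
rewrite -ext_liftI -(@kdiff_nat (coind V) (coind W)); [|exact: liftI_lmor|exact: liftI_rmor].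
congr (ext 0 _); apply: (@kdiff_eq (coind _)) => b.
rewrite -(IH (coind V) (coind W) (@liftI n m V W h)); last exact: liftI_rmor.
by apply: phi_eq => s _; apply/ffunP=> u; rewrite !ffunE.
Qed.

Lemma phiB p (V : bimod) (f g : seq cell -> V) a :
  phi p (fun s => f s - g s) a = phi p f a - phi p g a.
Proof.
elim: p V f g a => [|p IH] V f g a; first by rewrite !phi0; case: eqP => _; rewrite ?subr0.
rewrite !phiS.
rewrite -extB -(@kdiffB (coind V)); congr (ext 0 _); apply: (@kdiff_eq (coind _)) => b; rewrite
  -IH.
by apply: phi_eq => s _; apply/ffunP=> u; rewrite !ffunE.
Qed.

(** By [lead_delta] and induction the curried coboundary maps to [iota (phi f)] minus a [kdiff]
    image; a second [kdiff] kills the latter, and evaluation at 1 undoes [iota]. *)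
Lemma phi_delta (m0 : forall i, (0 < m i)%N) p (V : bimod) (f : seq cell -> V) a :
  phi p.+1 (delta f) a = kdiff (phi p f) a.
Proof.
elim: p V f a => [|p IH] V f a; last first.
  rewrite phiS.
  rewrite (_ : kdiff _ a = kdiff (fun b => iota (phi p.+1 f b) - kdiff (phi p (lead f)) b) a);
    last first.
    apply: kdiff_eq => b; rewrite -(IH (coind V)) -[iota _](@phi_nat _ V (coind V) (@iota n m
      V)); last exact: iota_rmor.
    rewrite -phiB; apply: (@phi_eq p.+1) => s ss; apply: lead_delta.
    by rewrite -size_eq0 ss.
  rewrite kdiffB kdiff_sq // subr0 (kdiff_nat (h := @iota n m V)); [|exact: iota_lmor|exact:
    iota_rmor].
  by rewrite ext_iota lact0.
(* In degree 1 only unit indices contribute. The function h e = x^e v - v x^e vanishes at e = 0, so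
   x_i - y_i followed by evaluation at 1 leaves h at x_i. *)
rewrite phiS /kdiff raddf_sum; apply: eq_bigr => i _.
rewrite /kdiff_dir; case: eqP => ai; rewrite ?raddf0 // raddf_signed; congr signed.
rewrite !phi0; case: eqP => e; rewrite ?raddf0 //=.
have {e ai} -> : odd (a i).
  have := congr1 (fun c : expo => c i) e; rewrite pred_atE eqxx zeroEE.
  by case: (a i) ai => [|[]].
pose h e := lact e (f [::]) - ract e (f [::]).
have eh c : ext c (lead (delta f) [::]) = h c.
  rewrite -(@ext_ffun _ m _ h); last by move=> e' ne; rewrite /h lact_out // ract_out // subr0.
  by congr ext; apply/ffunP=> u; rewrite !ffunE.
rewrite /step extB ext_shiftI ext_actI !eh add0r /h lact0 ract0 subrr raddf0 subr0.
by [].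
Qed.
End Bar.
Arguments delta_tail : simpl never.
Arguments step : simpl never.
Arguments phi : simpl never.

(** * Exactness on coinduced bimodules *)

Section Contraction.
Variables (n : nat) (m : 'I_n -> nat).
Local Notation bimod := (@bimod n m).
Local Notation cell := (@cell n m).
Local Notation expo := (@expo n).

Lemma set_at_unit (c : expo) i s t : set_at c i s + unit_at i t = set_at c i (s + t).
Proof.
by apply/ffunP=> j; rewrite addEE !set_atE unit_atE; case: eqP; rewrite ?addn0.
Qed.
Lemma add_unit (c : expo) i t : c + unit_at i t = set_at c i (c i + t).
Proof.
by apply/ffunP=> j; rewrite addEE set_atE unit_atE; case: eqP => [->|]; rewrite ?addn0.
Qed.
Lemma set_at_id (c : expo) i : set_at c i (c i) = c.
Proof. by apply/ffunP=> j; rewrite set_atE; case: eqP => [->|]. Qed.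
Lemma set_atK (c : expo) i s t : set_at (set_at c i s) i t = set_at c i t.
Proof. by apply/ffunP=> j; rewrite !set_atE; case: eqP. Qed.
Lemma set_at_unit_neq (c : expo) i j s t : i != j ->
  set_at c i s + unit_at j t = set_at (c + unit_at j t) i s.
Proof.
move=> ij; apply/ffunP=> l; rewrite addEE !set_atE addEE unit_atE.
by case: (eqVneq l i) => [->|//]; rewrite (negPf ij) addn0.
Qed.
Lemma add_unit_neq (c : expo) i j t : i != j -> (c + unit_at j t) i = c i.
Proof. by move=> ij; rewrite addEE unit_atE (negPf ij) addn0. Qed.

Lemma box_set_at (c : expo) i t : (c i < m i)%N -> ~~ box m c -> ~~ box m (set_at c i t).
Proof.
move=> ci; apply: contra => /boxP b; apply/boxP=> j.
by have := b j; rewrite set_atE; case: eqP => [->|].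
Qed.

Lemma pred_up (a : expo) i : pred_at (a + unit_at i 1) i = a.
Proof.
apply/ffunP=> j; rewrite pred_atE !addEE !unit_atE eqxx addn1 /=.
by case: eqP => [->|_]; rewrite ?addn0.
Qed.
Lemma up_pred (a : expo) i : a i != 0%N -> pred_at a i + unit_at i 1 = a.
Proof.
move=> ai; apply/ffunP=> j; rewrite addEE pred_atE unit_atE.
by case: eqP => [->|_]; rewrite ?addn0 // addn1 prednK // lt0n.
Qed.
Lemma koszul_sign_up i (a : expo) j : koszul_sign i (a + unit_at j 1) = (j < i)%N (+)
  koszul_sign i a.
Proof.
rewrite -[a in RHS](pred_up _ j) koszul_sign_pred ?addKb //.
by rewrite addEE unit_atE eqxx addn1.
Qed.

Section DirectionHomotopy.
Variables (V : bimod) (i : 'I_n) (N : bool -> {additive V -> V}).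
Hypothesis NC : forall j b b' v, i != j -> N b (step j b' v) = step j b' (N b v).
Implicit Types (g : expo -> V) (a : expo).

(** Carrying the same Koszul sign as [kdiff_dir], it anticommutes with the differentials of the
    other directions, while in direction i the two signs cancel. *)
Definition htpy g a : V := signed (koszul_sign i a) (N (odd (a i)) (g (a + unit_at i 1))).

Lemma homotopy_self g a : kdiff_dir i (htpy g) a + htpy (kdiff_dir i g) a =
  if a i == 0%N then N false (step i true (g a))
  else step i (odd (a i)) (N (~~ odd (a i)) (g a)) + N (odd (a i)) (step i (~~ odd (a i)) (g a)).
Proof.
rewrite /kdiff_dir /htpy pred_up addEE unit_atE eqxx addn1 /= [N _ (signed _ _)]raddf_signed
  koszul_sign_up.
rewrite ltnn addFb signedK; case: eqP => [-> | /eqP ai]; first by rewrite add0r.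
rewrite [step _ _ (signed _ _)]raddf_signed koszul_sign_pred // ltnn addFb signedK up_pred //.
by rewrite pred_atE eqxx; move: ai; case: (a i) => // p _ /=; rewrite negbK.
Qed.

Lemma homotopy_cross j g a : i != j -> kdiff_dir j (htpy g) a + htpy (kdiff_dir j g) a = 0.
Proof.
move=> ij; rewrite /kdiff_dir /htpy addEE unit_atE pred_atE [j == i]eq_sym (negPf ij) addn0.
case: eqP => [_|/eqP aj]; first by rewrite raddf0 raddf0 addr0.
have -> : pred_at a j + unit_at i 1 = pred_at (a + unit_at i 1) j.
  apply/ffunP=> l; rewrite addEE !pred_atE !addEE !unit_atE.
  by case: (eqVneq l j) => // ->; rewrite eq_sym (negPf ij) !addn0.
rewrite [step j _ (signed _ _)]raddf_signed [N _ (signed _ _)]raddf_signed /= NC //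
  koszul_sign_pred // koszul_sign_up.
have : (j < i)%N = ~~ (i < j)%N by rewrite -leqNgt ltn_neqAle val_eqE eq_sym ij.
move=> ->; set v := step _ _ (N _ _).
by case: (i < j)%N; case: koszul_sign; case: koszul_sign; rewrite /signed /= ?opprK ?addNr ?subrr.
Qed.

Lemma homotopy g a : (forall b, kdiff g b = 0) -> kdiff (htpy g) a =
  if a i == 0%N then N false (step i true (g a))
  else step i (odd (a i)) (N (~~ odd (a i)) (g a)) + N (odd (a i)) (step i (~~ odd (a i)) (g a)).
Proof.
move=> dg; have e0 : htpy (kdiff g) a = 0 by rewrite /htpy dg !raddf0.
rewrite -homotopy_self -[LHS]addr0 -[X in _ + X]e0.
have -> : htpy (kdiff g) a = \sum_j htpy (kdiff_dir j g) a.
  by rewrite /htpy /kdiff !raddf_sum.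
rewrite /kdiff -big_split /= (bigD1 i) //= big1 ?addr0 // => j ji.
by apply: homotopy_cross; rewrite eq_sym.
Qed.
End DirectionHomotopy.

Section Acyclicity.
Variable V : bimod.
Local Notation W := (coind V).
Implicit Types (G : W) (g : expo -> W) (a c : expo).

(* Dual to the right-linear contraction of the resolution of k[x_i]/(x_i^(m_i)):
   x^c e_{2b} |-> sum_(t < c) x^t e_{2b+1} y^(c-1-t) and
   x^(m_i-1) e_{2b+1} |-> e_{2b+2}. *)
Definition contr i (b : bool) G : W :=
  [ffun t => let c := cexp t in
    if b then if (c i).+1 == m i then ext (set_at c i 0) G else 0
    else if (c i < m i)%N
    then \sum_(t < c i) ract (unit_at i (c i - t.+1)) (ext (set_at c i t) G) else 0].

(** The element of the kernel of x_i - y_i that agrees with G at exponents with c_i = 0: powers of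
    x_i are moved to the right. *)
Definition base i G : W :=
  [ffun t => let c := cexp t in
    if (c i < m i)%N then ract (unit_at i (c i)) (ext (set_at c i 0) G) else 0].

Lemma ext_contr_odd i G c :
  ext c (contr i true G) = if (c i).+1 == m i then ext (set_at c i 0) G else 0.
Proof.
apply: (@ext_ffun _ m V (fun c => if (c i).+1 == m i then ext (set_at c i 0) G else 0)).
by move=> {}c nb; case: eqP => // e; rewrite ext_out // box_set_at // -e.
Qed.

Lemma ext_contr_even i G c :
  ext c (contr i false G) = if (c i < m i)%N
    then \sum_(t < c i) ract (unit_at i (c i - t.+1)) (ext (set_at c i t) G) else 0.
Proof.
apply: (@ext_ffun _ m V (fun c => if (c i < m i)%N then
  \sum_(t < c i) ract (unit_at i (c i - t.+1)) (ext (set_at c i t) G) else 0)).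
move=> {}c nb; case: ifP => // e; rewrite big1 // => t _.
by rewrite ext_out ?raddf0 // box_set_at.
Qed.

Lemma ext_base i G c :
  ext c (base i G) = if (c i < m i)%N then ract (unit_at i (c i)) (ext (set_at c i 0) G) else 0.
Proof.
apply: (@ext_ffun _ m V (fun c => if (c i < m i)%N then
  ract (unit_at i (c i)) (ext (set_at c i 0) G) else 0)).
by move=> {}c nb; case: ifP => // e; rewrite ext_out ?raddf0 // box_set_at.
Qed.

Lemma base0 i : base i 0 = 0.
Proof. by apply: ext_inj => c _; rewrite ext_base !ext0 raddf0; case: ifP. Qed.

Lemma ext_step_odd i G c : ext c (step i true G) =
  ext (c + unit_at i 1) G - ract (unit_at i 1) (ext c G).
Proof. by rewrite /step extB ext_shiftI ext_actI. Qed.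
Lemma ext_step_even i G c : ext c (step i false G) =
  \sum_(t < m i) ract (unit_at i (m i - t.+1)) (ext (c + unit_at i t) G).
Proof.
by rewrite /step ext_sum; apply: eq_bigr => t _; rewrite ext_shiftI ext_actI.
Qed.

Lemma contr_is_additive i b : zmod_morphism (contr i b).
Proof.
move=> F G; apply: ext_inj => c _; rewrite extB; case: b.
  by rewrite !ext_contr_odd extB; case: eqP; rewrite ?subr0.
rewrite !ext_contr_even; case: ifP; rewrite ?subr0 // => _.
by rewrite -sumrB; apply: eq_bigr => t _; rewrite extB raddfB.
Qed.
HB.instance Definition _ i b := GRing.isZmodMorphism.Build W W (contr i b) (contr_is_additive i
  b).

Lemma contr_step_odd i G : contr i false (step i true G) = G - base i G.
Proof.
apply: ext_inj => c /boxP/(_ i) ci; rewrite extB ext_contr_even ext_base ci.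
pose w t := ract (unit_at i (c i - t)) (ext (set_at c i t) G).
rewrite (eq_bigr (fun t : 'I_(c i) => w t.+1 - w t)); last first.
  move=> t _; rewrite ext_step_odd set_at_unit addn1 raddfB /= -ractD -unit_atD.
  by congr (_ - ract (unit_at i _) _); rewrite addn1 subnSK.
rewrite -(big_mkord xpredT (fun t => w t.+1 - w t)) telescope_sumr // /w.
by rewrite subnn unit_at0 ract0 set_at_id subn0.
Qed.

Lemma step_contr_even i G : step i false (contr i true G) = base i G.
Proof.
apply: ext_inj => c /boxP/(_ i) ci; rewrite ext_step_even ext_base ci.
(* [contr i true] lives on exponent m_i - 1 in direction i, which only the summand t = m_i - 1 - c_i
   of the norm reaches. *)
have lt : (m i - (c i).+1 < m i)%N by lia.
rewrite (bigD1 (Ordinal lt)) //= big1 ?addr0.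
  rewrite ext_contr_odd add_unit set_atE eqxx set_atK.
  have -> : (c i + (m i - (c i).+1)).+1 = m i by lia.
  by rewrite eqxx; congr (ract (unit_at i _) _); lia.
move=> t /eqP ne; rewrite ext_contr_odd add_unit set_atE eqxx.
case: eqP => [e|_]; last by rewrite raddf0.
by case: ne; apply: val_inj => /=; lia.
Qed.

Lemma contr_homotopy_odd i G : step i true (contr i false G) + contr i true (step i false G) = G.
Proof.
apply: ext_inj => c /boxP/(_ i) ci; rewrite extD ext_step_odd ext_contr_odd !ext_contr_even ci.
rewrite add_unit set_atE eqxx addn1.
have Y1 : ract (unit_at i 1)
    (\sum_(t < c i) ract (unit_at i (c i - t.+1)) (ext (set_at c i t) G)) =
    \sum_(t < c i) ract (unit_at i (c i - t)) (ext (set_at c i t) G).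
  rewrite raddf_sum; apply: eq_bigr => t _; rewrite /= -ractD -unit_atD.
  by rewrite add1n subnSK.
(* If c_i + 1 < m_i, the last summand after the shift is G and the rest cancels against the right
   action. If c_i = m_i - 1, the shift leaves the box and the last summand of the norm supplies
   G. *)
rewrite Y1; case: ifP => lt.
  rewrite big_ord_recr /= set_atK subnn unit_at0 ract0 set_at_id.
  rewrite (eq_bigr (fun t : 'I_(c i) => ract (unit_at i (c i - t)) (ext (set_at c i t) G))).
    rewrite [_ + ext c G]addrC addrK -[RHS]addr0.
    by congr (_ + _); case: eqP => // e; lia.
  by move=> t _; rewrite set_atK subSS.
have e : (c i).+1 = m i by lia.
rewrite e eqxx ext_step_even -e big_ord_recr /=.
rewrite subnn unit_at0 ract0 set_at_unit add0n set_at_id.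
rewrite sub0r [X in _ + (X + _)](eq_bigr (fun t : 'I_(c i) =>
  ract (unit_at i (c i - t)) (ext (set_at c i t) G))); first by rewrite addKr.
by move=> t _; rewrite set_at_unit add0n subSS.
Qed.

Lemma contr_lact i b j t G : i != j ->
  contr i b (lact (unit_at j t) G) = lact (unit_at j t) (contr i b G).
Proof.
move=> ij; apply: ext_inj => c _; rewrite /= ext_shiftI; case: b.
  by rewrite !ext_contr_odd ext_shiftI set_at_unit_neq // add_unit_neq.
rewrite !ext_contr_even add_unit_neq //; case: ifP => // _.
by apply: eq_bigr => s _; rewrite ext_shiftI set_at_unit_neq.
Qed.

Lemma contr_ract i b c G : contr i b (ract c G) = ract c (contr i b G).
Proof.
apply: ext_inj => u _; rewrite /= ext_actI; case: b.
  by rewrite !ext_contr_odd ext_actI; case: eqP; rewrite ?raddf0.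
rewrite !ext_contr_even; case: ifP => _; rewrite ?raddf0 // raddf_sum.
by apply: eq_bigr => s _; rewrite ext_actI /= ract_comm.
Qed.

Lemma contr_step i b j b' G : i != j -> contr i b (step j b' G) = step j b' (contr i b G).
Proof.
move=> ij; case: b'; rewrite /step; first by rewrite raddfB /= contr_lact // contr_ract.
by rewrite raddf_sum; apply: eq_bigr => t _; rewrite /= contr_lact // contr_ract.
Qed.

Definition base_at i g a : W := if a i == 0%N then base i (g a) else 0.

Lemma homotopy_base i g a : (forall b, kdiff g b = 0) ->
  kdiff (htpy i (fun b => contr i b : {additive W -> W}) g) a = g a - base_at i g a.
Proof.
move=> dg; rewrite homotopy // => [|j b b' v ij]; last exact: contr_step.
rewrite /base_at; case: eqP => _ /=; first by rewrite contr_step_odd.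
rewrite subr0; case: (odd _) => /=; last by rewrite step_contr_even contr_step_odd addrC subrK.
exact: contr_homotopy_odd.
Qed.

(** Directions are cleared one at a time: modulo a coboundary, g is replaced by a cocycle supported
    on a_i = 0. Since [base] maps 0 to 0, directions already cleared stay cleared, and finally only
    the index 0 is left. *)
Lemma small_acyclic (m0 : forall i, (0 < m i)%N) g :
  (forall a, kdiff g a = 0) -> g 0 = 0 -> exists h, forall a, g a = kdiff h a.
Proof.
move=> dg g0.
suff [g' [h [gh g'0 g'1]]] : exists g' h, [/\ forall a, g a - g' a = kdiff h a, g' 0 = 0 &
    forall a i, i \in enum 'I_n -> a i != 0%N -> g' a = 0].
  exists h => a; rewrite -gh.
  suff -> : g' a = 0 by rewrite subr0.
  case: (eqVneq a 0) => [->//|]; move/eqP=> a0.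
  have [i ai] : exists i, a i != 0%N.
    apply/existsP; apply: contra_notT a0 => /existsPn a0; apply/ffunP=> i.
    by rewrite zeroEE; apply/eqP; rewrite -[_ == _]negbK a0.
  by apply: (g'1 a i) => //; rewrite mem_enum.
elim: (enum 'I_n) => [|i l [g' [h [gh g'0 g'1]]]].
  exists g, (fun=> 0); split=> // a; rewrite subrr /kdiff big1 // => i _.
  by rewrite /kdiff_dir; case: eqP => // _; rewrite !raddf0.
have dg' a : kdiff g' a = 0.
  have : kdiff (fun b => g b - g' b) a = kdiff (kdiff h) a by apply: kdiff_eq.
  by rewrite kdiff_sq // kdiffB dg sub0r => /eqP; rewrite oppr_eq0 => /eqP.
exists (base_at i g'), (fun b => h b + htpy i (fun b => contr i b : {additive W -> W}) g' b);
  split.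
- by move=> a; rewrite kdiffD -gh homotopy_base // subrKA.
- by rewrite /base_at g'0 zeroEE eqxx base0.
by move=> a j; rewrite in_cons /base_at => /orP[/eqP ->|jl] aj; rewrite ?(negPf aj) //;
  rewrite (g'1 _ _ jl aj) base0; case: ifP.
Qed.
End Acyclicity.
End Contraction.

(** * Comparison *)

Section Comparison.
Variables (n : nat) (m : 'I_n -> nat).
Hypothesis m0 : forall i, (0 < m i)%N.
Local Notation bimod := (@bimod n m).
Local Notation cell := (@cell n m).
Local Notation expo := (@expo n).

Definition bar_cobound p (V : bimod) (f : seq cell -> V) : Prop :=
  if p is p'.+1 then exists h, forall s, size s = p'.+1 -> f s = delta h s
  else f [::] = 0.

Definition deg (a : expo) := (\sum_i a i)%N.

Lemma deg_pred (a : expo) i : a i != 0%N -> deg a = (deg (pred_at a i)).+1.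
Proof.
move=> ai; rewrite /deg !(bigD1 i (P := xpredT)) //= pred_atE eqxx -addSn prednK ?lt0n //.
by congr (_ + _)%N; apply: eq_bigr => j /negPf ji; rewrite pred_atE ji.
Qed.

Lemma deg0 : deg 0 = 0%N.
Proof. by rewrite /deg big1 // => i _; rewrite zeroEE. Qed.

Lemma expo_eq0P (a : expo) : a != 0 -> exists i, a i != 0%N.
Proof.
move=> a0; apply/existsP; apply: contraNT a0 => /existsPn a0; apply/eqP/ffunP=> i.
by rewrite zeroEE; apply/eqP; rewrite -[_ == _]negbK a0.
Qed.

Lemma kdiff_supp p (V : bimod) (g : expo -> V) a :
  (forall b, deg b != p -> g b = 0) -> deg a != p.+1 -> kdiff g a = 0.
Proof.
move=> g0 da; rewrite /kdiff big1 // => i _; rewrite /kdiff_dir; case: eqP => // /eqP ai.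
by rewrite g0 ?raddf0 //; rewrite (deg_pred ai) eqSS in da.
Qed.

Lemma phi_supp p (V : bimod) (f : seq cell -> V) a : deg a != p -> phi p f a = 0.
Proof.
elim: p V f a => [|p IH] V f a da.
  by rewrite phi0; case: (eqVneq a 0) da => [->|//]; rewrite deg0.
by rewrite phiS (kdiff_supp (p := p)) ?raddf0 // => b db; apply: IH.
Qed.

(** [kdiff] raises the total degree by exactly one, so a primitive may be truncated to a single
    degree. *)
Lemma kdiff_restrict p (V : bimod) (g w : expo -> V) :
  (forall a, deg a != p.+1 -> w a = 0) -> (forall a, w a = kdiff g a) ->
  let g' := fun b => if deg b == p then g b else 0 in forall a, w a = kdiff g' a.
Proof.
move=> w0 wg g' a; case: (eqVneq (deg a) p.+1) => da; last first.
  by rewrite w0 // (kdiff_supp (p := p)) // => b /negPf db; rewrite /g' db.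
rewrite wg; apply: eq_bigr => i _; rewrite /kdiff_dir; case: eqP => // /eqP ai.
by rewrite /g'; move: da; rewrite (deg_pred ai) => -[->]; rewrite eqxx.
Qed.

Lemma lact_eq_ract (V : bimod) (v : V) c :
  (forall i, step i true v = 0) -> lact c v = ract c v.
Proof.
move=> dv; have [d] := ubnP (deg c); elim: d c => // d IH c.
case: (eqVneq c 0) => [-> _|/expo_eq0P[i ci]]; first by rewrite lact0 ract0.
rewrite (deg_pred ci) ltnS => lt; rewrite -[c](up_pred ci) lactD.
have /eqP := dv i; rewrite /step subr_eq0 => /eqP ->.
by rewrite lractC IH // addrC ractD.
Qed.

Lemma kdiff_unit (V : bimod) (g : expo -> V) i : kdiff g (unit_at i 1) = step i true (g 0).
Proof.
rewrite /kdiff (bigD1 i) //= big1 ?addr0 => [|j ji]; last first.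
  by rewrite /kdiff_dir unit_atE (negPf ji).
rewrite /kdiff_dir unit_atE eqxx /=.
have -> : koszul_sign i (unit_at i 1) = false.
  rewrite /koszul_sign big1 // => j ji; rewrite unit_atE; case: eqP => // e.
  by rewrite e ltnn in ji.
by rewrite /signed; congr (step _ _ (g _)); rewrite -[unit_at i 1]add0r pred_up.
Qed.

Lemma proj_iota (V : bimod) (v : V) : proj (iota v) = 0.
Proof. by apply: ext_inj => c _; rewrite ext_proj !ext_iota lact0 subrr ext0. Qed.

Lemma proj_proj (V : bimod) (F : coind V) : proj (proj F) = proj F.
Proof. by rewrite {1}/proj ext_proj lact0 subrr raddf0 subr0. Qed.

Lemma proj_lmor (V : bimod) : lmor (V := coind V) (W := coker V m0) (@proj n m V).
Proof.
move=> c F; case: (eqVneq c 0) => [->|c0]; first by rewrite !lact0.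
apply: ext_inj => u _; rewrite /= ext_shiftJ // !ext_proj !ext_shiftI add0r lactD.
by rewrite raddfB /= opprB subrKA.
Qed.
Lemma proj_rmor (V : bimod) : rmor (V := coind V) (W := coker V m0) (@proj n m V).
Proof.
by move=> c F; apply: ext_inj => u _; rewrite /= ext_actI !ext_proj !ext_actI raddfB /= lractC.
Qed.
Lemma proj_lmorJ (V : bimod) : lmor (V := coker V m0) (W := coker V m0) (@proj n m V).
Proof.
move=> c F; case: (eqVneq c 0) => [->|c0]; first by rewrite !lact0.
apply: ext_inj => u _; rewrite /= !ext_proj !ext_shiftJ // !ext_proj add0r lact0 subrr raddf0.
by rewrite subr0 lactD raddfB /= opprB subrKA.
Qed.
Lemma proj_rmorJ (V : bimod) : rmor (V := coker V m0) (W := coker V m0) (@proj n m V).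
Proof. exact: proj_rmor. Qed.

Lemma proj_eq0 (V : bimod) (F : coind V) : proj F = 0 -> F = iota (ext 0 F).
Proof. by move=> e; apply/eqP; rewrite -subr_eq0 -/(proj F) e. Qed.

(* Dimension shifting along 0 -> V -> coind V -> coker V -> 0. *)
Theorem phi_injective p (V : bimod) (f : seq cell -> V) :
  (forall s, size s = p.+1 -> delta f s = 0) ->
  (exists g, forall a, phi p f a = kdiff g a) -> bar_cobound p f.
Proof.
elim: p V f => [|p IH] V f cf [g fg].
  by have := fg 0; rewrite phi0 eqxx kdiff0.
(* The truncation makes [g1] vanish at index 0 when p > 0, as [small_acyclic] will require. *)
have [g1 {}fg g1s] : exists2 g1, forall a, phi p.+1 f a = kdiff g1 a &
    forall b, deg b != p -> g1 b = 0.
  exists (fun b => if deg b == p then g b else 0); last by move=> b /negPf ->.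
  exact: kdiff_restrict (@phi_supp p.+1 V f) fg.
pose F := lead f.
have cF s : size s = p.+1 -> delta F s = iota (f s).
  move=> ss; apply/eqP; rewrite eq_sym -subr_eq0 -lead_delta -?size_eq0 ?ss //.
  by apply/eqP/ffunP=> u; rewrite !ffunE cf //= ss.
(* Both terms have [kdiff] equal to [iota (phi f)], so w is a cocycle of K in the coinduced
   bimodule. *)
pose w b := phi p F b - iota (g1 b).
have dw a : kdiff w a = 0.
  rewrite kdiffB -phi_delta // (phi_eq (g := fun s => iota (f s))) //.
  rewrite (@phi_nat _ _ _ V (coind V) (@iota n m V)); last exact: iota_rmor.
  by rewrite (kdiff_nat (h := @iota n m V)) ?fg ?subrr; [|exact: iota_lmor|exact: iota_rmor].
case: p => [|p] in IH cf fg g1s cF w dw *.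
  (* When f has degree 1, the cocycle w is one element on which the two actions agree. Hence F and
     [iota (g1 0)] have the same coboundary, which reads f = delta (g1 0). *)
  exists (fun=> g1 0) => -[|c [|//]] // _.
  have inv : lact (cexp c) (w 0) = ract (cexp c) (w 0).
    by apply: lact_eq_ract => i; rewrite -kdiff_unit dw.
  have : delta (fun s => F s - iota (g1 0)) [:: c] = 0.
    move: inv; rewrite /w phi0 eqxx => inv.
    by rewrite /delta delta_tail1 inv subrr.
  rewrite deltaB cF // (@delta_nat _ _ _ _ (@iota n m V) (fun=> g1 0)); [|exact:
    iota_lmor|exact: iota_rmor].
  by move/eqP; rewrite subr_eq0 => /eqP/(congr1 (ext 0)); rewrite !ext_iota !lact0.
have w0 : w 0 = 0.
  by rewrite /w phi_supp ?deg0 // g1s ?deg0 // raddf0 subr0.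
have [h wh] := small_acyclic m0 dw w0.
(* In the quotient F becomes a cocycle, and its image under [phi] is the coboundary of [proj h],
   since [proj] kills [iota g1]. *)
have [||G FG] := IH (coker V m0) (fun s => proj (F s)).
- move=> s ss; rewrite (@delta_nat _ _ (coind V) (coker V m0) (@proj n m V)); [|exact:
  proj_lmor|exact: proj_rmor].
  by rewrite /= cF // proj_iota.
- exists (fun a => proj (h a)) => a.
  rewrite (@phi_nat _ _ _ (coind V) (coker V m0) (@proj n m V)); last exact: proj_rmor.
  rewrite (@kdiff_nat _ _ (coind V) (coker V m0) (@proj n m V)); [|exact: proj_lmor|exact:
    proj_rmor].
  by rewrite -wh /w raddfB /= proj_iota subr0.
(* The carriers of [coker] and [coind] coincide, so G lifts as it stands. Then F - delta G' lies in
   the image of [iota], and its preimage [f'] is the primitive of f. *)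
pose G' : seq cell -> coind V := G.
pose f' s := ext 0 (F s - delta G' s).
have Ff s : size s = p.+1 -> F s - delta G' s = iota (f' s).
  move=> ss; apply: proj_eq0; rewrite raddfB /= -proj_proj FG //.
  rewrite -(@delta_nat _ _ (coker V m0) (coker V m0) (@proj n m V)); [|exact: proj_lmorJ|exact:
    proj_rmorJ].
  by rewrite -(@delta_nat _ _ (coind V) (coker V m0) (@proj n m V)) ?subrr; [|exact:
    proj_lmor|exact: proj_rmor].
exists f' => s ss; have : delta (fun s => F s - delta G' s) s = iota (f s).
  by rewrite deltaB delta_delta subr0 cF.
rewrite (delta_eq (g := fun s => iota (f' s))); last first.
  by move=> r; rewrite ss => -[rr]; apply: Ff.
rewrite (@delta_nat _ _ _ _ (@iota n m V)); [|exact: iota_lmor|exact: iota_rmor].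
by move/(congr1 (ext 0)); rewrite !ext_iota !lact0.
Qed.

(** * Multigradings and their preservation by [phi] *)

Definition tot (s : seq cell) : expo := \sum_(c <- s) cexp c.
(* Multidegree of the generator of the small complex indexed by [a]. *)
Definition wt (a : expo) : expo := [ffun i => (m i * (a i)./2 + odd (a i))%N].

Record graded (V : bimod) (G : expo -> V -> Prop) : Prop := Graded {
  gr0 : forall c, G c 0;
  grB : forall c u v, G c u -> G c v -> G c (u - v);
  grX : forall c c' v, G c v -> G (c + c') (lact c' v);
  grY : forall c c' v, G c v -> G (c + c') (ract c' v) }.

(** The curried argument x^u contributes its own exponent, so F of degree c takes values of degree c
    + u. *)
Definition coind_gr (V : bimod) (G : expo -> V -> Prop) (c : expo) (F : coind V) : Prop :=
  forall u, G (c + u) (ext u F).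

Section Graded.
Variables (V : bimod) (G : expo -> V -> Prop).
Hypothesis gG : graded G.

Lemma grN c v : G c v -> G c (- v).
Proof. by move=> gv; rewrite -sub0r; apply: grB => //; apply: gr0. Qed.
Lemma grD c u v : G c u -> G c v -> G c (u + v).
Proof. by move=> gu gv; rewrite -[v]opprK; apply: grB => //; apply: grN. Qed.
Lemma gr_sum (I : Type) (r : seq I) (P : pred I) (E : I -> V) c :
  (forall i, P i -> G c (E i)) -> G c (\sum_(i <- r | P i) E i).
Proof. by move=> e; elim/big_ind: _ => //; [apply: gr0 | move=> *; apply: grD]. Qed.

Lemma coind_graded : graded (coind_gr G).
Proof.
split=> [c u|c u v gu gv w|c c' v gv u|c c' v gv u].
- by rewrite ext0; apply: gr0.
- by rewrite extB; apply: grB.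
- by rewrite ext_shiftI -addrA [c' + u]addrC.
- by rewrite ext_actI -addrA [c' + u]addrC addrA; apply: grY.
Qed.

Lemma ext_gr d c (E : {ffun cell -> V}) :
  (forall u : cell, cexp u = c -> G d (E u)) -> G d (ext c E).
Proof. by move=> e; apply: gr_sum => u /eqP; apply: e. Qed.

Lemma delta_tail_gr w f s :
  (forall r, G (w + tot r) (f r)) -> G (w + tot s) (delta_tail f s).
Proof.
elim: s w f => [|c [|c' s] IH] w f gf; first exact: gr0.
  rewrite delta_tail1 /tot big_seq1; apply: grY => //.
  by have := gf [::]; rewrite /tot big_nil addr0.
rewrite delta_tail2; apply: grB => //.
  rewrite /tot !big_cons [cexp c + _]addrA; apply: gr_sum => u /eqP <-.
  by rewrite ffunE; have := gf (u :: s); rewrite /tot big_cons.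
rewrite /tot big_cons addrA; apply: IH => r.
by have := gf (c :: r); rewrite /tot big_cons addrA.
Qed.

Lemma delta_gr f s : (forall r, G (tot r) (f r)) -> G (tot s) (delta f s).
Proof.
move=> gf; case: s => [|c s]; first exact: gr0.
apply: grB => //; last by rewrite -[tot _]add0r; apply: delta_tail_gr => r; rewrite add0r.
by rewrite /tot big_cons addrC; apply: grX => //; apply: gf.
Qed.

Lemma wt0 : wt 0 = 0.
Proof. by apply/ffunP=> i; rewrite ffunE zeroEE muln0. Qed.

Lemma wt_pred (a : expo) i : a i != 0%N ->
  wt a = wt (pred_at a i) + unit_at i (if odd (a i) then 1%N else (m i).-1).
Proof.
move=> ai; apply/ffunP=> j; rewrite addEE unit_atE !ffunE.
case: eqP => [->|_]; last by rewrite addn0.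
have := m0 i; move: ai; case: (a i) => // p _ mi /=; rewrite uphalf_half.
by case: (odd p) => /=; rewrite mulnDr ?muln1 ?muln0; lia.
Qed.

Lemma kdiff_gr g a : (forall b, G (wt b) (g b)) -> G (wt a) (kdiff g a).
Proof.
move=> gg; apply: gr_sum => i _; rewrite /kdiff_dir; case: eqP => [_|/eqP ai]; first exact: gr0.
suff : G (wt a) (step i (odd (a i)) (g (pred_at a i))).
  by move=> ?; rewrite /signed; case: ifP => _ //; apply: grN.
rewrite (wt_pred ai) /step; case: (odd (a i)).
  by apply: grB => //; [apply: grX|apply: grY].
apply: gr_sum => t _.
have -> : (m i).-1 = ((m i - t.+1) + t)%N by have := ltn_ord t; lia.
by rewrite unit_atD addrA; apply: grX => //; apply: grY.
Qed.
End Graded.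

Lemma phi_gr p (V : bimod) (G : expo -> V -> Prop) f a : graded G ->
  (forall s, G (tot s) (f s)) -> G (wt a) (phi p f a).
Proof.
elim: p V G f a => [|p IH] V G f a gG gf.
  rewrite phi0; case: eqP => [->|_]; last exact: gr0.
  by rewrite wt0; have := gf [::]; rewrite /tot big_nil.
rewrite phiS -[wt a]addr0.
suff H : coind_gr G (wt a) (kdiff (phi p (lead f)) a) by apply: H.
apply: (kdiff_gr (coind_graded gG)) => b; apply: (IH (coind V) _ _ _ (coind_graded gG)) => s u.
apply: ext_gr => // c <-; rewrite ffunE addrC.
by have := gf (c :: s); rewrite /tot big_cons.
Qed.
End Comparison.

(** * Twisted coefficients *)

Section Twisted.
Variables (n : nat) (m : 'I_n -> nat) (k : fieldType).
Hypothesis m2 : forall i, (1 < m i)%N.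
Local Notation bimod := (@bimod n m).
Local Notation cell := (@cell n m).
Local Notation expo := (@expo n).
Local Notation W := ({ffun cell -> k}).

Let m0 i : (0 < m i)%N. Proof. exact: ltnW. Qed.

Lemma phi_sum p (V : bimod) (I : Type) (r : seq I) (P : pred I) (F : I -> seq cell -> V) a :
  phi p (fun s => \sum_(i <- r | P i) F i s) a = \sum_(i <- r | P i) phi p (F i) a.
Proof.
elim: p V F a => [|p IH] V F a.
  by rewrite phi0; under [RHS]eq_bigr do rewrite phi0; case: eqP => // _; rewrite big1_eq.
rewrite phiS; under [RHS]eq_bigr do rewrite phiS.
rewrite -raddf_sum /=; congr (ext 0 _).
rewrite [RHS]exchange_big; apply: eq_bigr => i _; rewrite -(@kdiff_dir_sum _ _ (coind V)).
apply: (@kdiff_dir_eq _ _ (coind V)) => b; rewrite -IH.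
by apply: phi_eq => s _; apply/ffunP=> u; rewrite !(ffunE, sum_ffunE); apply: eq_bigr => j _;
  rewrite ffunE.
Qed.

Definition scl (x : k) (v : W) : W := [ffun t => x * v t].
Lemma ext_scl x c v : ext c (scl x v) = x * ext c v.
Proof. by rewrite /ext mulr_sumr; apply: eq_bigr => t _; rewrite ffunE. Qed.
Lemma scl_is_additive x : zmod_morphism (scl x).
Proof. by move=> u v; apply/ffunP=> t; rewrite !ffunE mulrBr. Qed.
HB.instance Definition _ x := GRing.isZmodMorphism.Build W W (scl x) (scl_is_additive x).

Section Module.
Variable lam : {ffun 'I_n -> k}.

Definition chi (c : expo) : k := \prod_i lam i ^+ c i.
Lemma chi0 : chi 0 = 1.
Proof. by rewrite /chi big1 // => i _; rewrite zeroEE expr0. Qed.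
Lemma chiD c c' : chi (c + c') = chi c * chi c'.
Proof. by rewrite /chi -big_split; apply: eq_bigr => i _; rewrite addEE exprD. Qed.
Lemma chi_unit i t : chi (unit_at i t) = lam i ^+ t.
Proof.
rewrite /chi (bigD1 i) //= unit_atE eqxx big1 ?mulr1 // => j /negPf ji.
by rewrite unit_atE ji expr0.
Qed.

Definition twX (c : expo) (v : W) : W := scl (chi c) (shiftI c v).

Lemma ext_twX c u v : ext u (twX c v) = chi c * ext (u + c) v.
Proof. by rewrite ext_scl ext_shiftI. Qed.

Lemma twX_add c : zmod_morphism (twX c).
Proof. by move=> u v; rewrite /twX shiftI_add raddfB. Qed.
Lemma twX0 v : twX 0 v = v.
Proof. by apply: ext_inj => u _; rewrite ext_twX chi0 mul1r addr0. Qed.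
Lemma twXD c c' v : twX (c + c') v = twX c (twX c' v).
Proof. by apply: ext_inj => u _; rewrite !ext_twX chiD mulrA addrA. Qed.
Lemma twX_out c v : ~~ box m c -> twX c v = 0.
Proof. by move=> nb; rewrite /twX shiftI_out // raddf0. Qed.
Lemma twXY c c' v : twX c (shiftI c' v) = shiftI c' (twX c v).
Proof.
by apply: ext_inj => u _; rewrite ext_shiftI !ext_twX ext_shiftI addrAC.
Qed.

(* The truncated polynomial algebra with left action twisted by [chi]; it is
   self-dual, and the value at [t] is the coefficient of the monomial whose
   exponent is complementary to [t], so that both actions are shifts. *)
Definition tw : bimod :=
  Bimod twX_add (@shiftI_add _ _ k) twX0 (@shiftI0 _ _ k) twXD (@shiftID _ _ k)
    twX_out (@shiftI_out _ _ k) twXY.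

(** The coordinate t stands for the monomial of exponent top - t, so a cochain whose value on s is
    graded by [tot s] has multidegree top - tau. Thus tau = top is multidegree 0 and tau = 0 is the
    multidegree of U. *)
Definition tw_grading (tau c : expo) (v : tw) : Prop := forall t, t + c != tau -> ext t v = 0.

Lemma tw_graded tau : graded (tw_grading tau).
Proof.
split=> [c t _|c u v gu gv t ne|c c' v gv t ne|c c' v gv t ne].
- by rewrite ext0.
- by rewrite extB gu // gv // subr0.
- by rewrite /= ext_twX gv ?mulr0 // -addrA [c' + c]addrC.
- by rewrite /= ext_shiftI gv // -addrA [c' + c]addrC.
Qed.

Definition step_coef i (b : bool) : k := if b then lam i - 1 else \sum_(s < m i) lam i ^+ s.
Definition step_shift i (b : bool) : nat := if b then 1%N else (m i).-1.

Lemma ext_step i b (v : tw) t : ext t (step i b v) = step_coef i b * ext (t + unit_at i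
  (step_shift i b)) v.
Proof.
rewrite /step /step_coef /step_shift; case: b.
  by rewrite extB ext_twX ext_shiftI chi_unit expr1 mulrBl mul1r.
rewrite ext_sum mulr_suml; apply: eq_bigr => s _.
rewrite ext_twX ext_shiftI chi_unit -addrA -unit_atD.
by congr (_ * ext (_ + unit_at i _) _); have := ltn_ord s; lia.
Qed.

Section Contract.
Variable i : 'I_n.

(* Inverse of [step i (~~ b)] where the latter is defined. *)
Definition twcontr (b : bool) (v : W) : W :=
  [ffun t => let c := cexp t in
    if (step_shift i (~~ b) <= c i < m i)%N
    then (step_coef i (~~ b))^-1 * ext (set_at c i (c i - step_shift i (~~ b))) v else 0].

Lemma ext_twcontr b v c : ext c (twcontr b v) = if (step_shift i (~~ b) <= c i < m i)%N
    then (step_coef i (~~ b))^-1 * ext (set_at c i (c i - step_shift i (~~ b))) v else 0.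
Proof.
apply: (@ext_ffun _ m k (fun c => if (step_shift i (~~ b) <= c i < m i)%N
    then (step_coef i (~~ b))^-1 * ext (set_at c i (c i - step_shift i (~~ b))) v else 0)).
move=> {}c nb; case: ifP => // /andP[_ lt].
by rewrite ext_out ?mulr0 // box_set_at.
Qed.

Lemma twcontr_is_additive b : zmod_morphism (twcontr b).
Proof.
move=> u v; apply: ext_inj => c _; rewrite extB !ext_twcontr extB.
by case: ifP; rewrite ?subr0 // mulrBr.
Qed.
HB.instance Definition _ b := GRing.isZmodMorphism.Build W W (twcontr b) (twcontr_is_additive b).

Lemma twcontr_step j b b' (v : tw) : i != j -> twcontr b (step j b' v : tw) = (step j b'
  (twcontr b v : tw) : W).
Proof.
move=> ij; apply: ext_inj => c _; rewrite ext_step !ext_twcontr add_unit_neq //.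
case: ifP => _; last by rewrite mulr0.
by rewrite ext_step set_at_unit_neq // mulrCA.
Qed.

Definition twhtpy : (expo -> tw) -> expo -> tw := htpy i (fun b => twcontr b : {additive tw ->
  tw}).

(** For a_i > 0 the two composites of [twcontr] with [step] are the identity on complementary ranges
    of c_i. For a_i = 0 only one composite exists, and it misses c_i = 0. *)
Lemma twhtpy_id (tau : expo) (g : expo -> tw) a : (forall b, step_coef i b != 0) -> tau i !=
  0%N ->
  (forall b, tw_grading tau (wt m b) (g b)) -> (forall b, kdiff g b = 0) -> kdiff (twhtpy g) a
    = g a.
Proof.
move=> kap0 ti gg dg; rewrite homotopy // => [|j b b' v ij]; last exact: twcontr_step.
have mi := m2 i.
have RD b v c : box m c -> ext c (twcontr b (step i (~~ b) v : tw)) =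
    if (step_shift i (~~ b) <= c i)%N then ext c v else 0.
  move/boxP/(_ i) => ci; rewrite ext_twcontr ci andbT; case: ifP => // le.
  by rewrite ext_step mulKf ?kap0 // set_at_unit subnK // set_at_id.
have DR b v c : box m c -> ext c (step i b (twcontr (~~ b) v : tw)) =
    if (c i + step_shift i b < m i)%N then ext c v else 0.
  move/boxP/(_ i) => ci; rewrite ext_step ext_twcontr negbK addEE unit_atE eqxx leq_addl /=.
  case: ifP => lt; last by rewrite mulr0.
  by rewrite mulVKf ?kap0 // addnK add_unit set_atK set_at_id.
case: eqP => [ai|_]; apply: ext_inj => c bc.
  (* With a_i = 0 the grading says c_i = tau_i, so the missed case c_i = 0 is excluded by tau_i
     being nonzero. *)
  rewrite (RD false) //= /step_shift; case: ltnP => // c0.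
  rewrite gg //; apply: contra ti => /eqP <-; rewrite addEE ffunE ai muln0 /=.
  by move: c0; case: (c i).
rewrite extD DR // -{3}[odd (a i)]negbK RD //; move/boxP/(_ i): bc => ci.
by case: (odd (a i)); rewrite /step_shift /=;
  case: ifP => h1; case: ifP => h2; rewrite ?add0r ?addr0 //; lia.
Qed.
End Contract.

Lemma addE_injl (a b c : expo) : c + a = c + b -> a = b.
Proof.
move=> /ffunP e; apply/ffunP=> i; apply/eqP; move/eqP: (e i).
by rewrite !addEE eqn_add2l.
Qed.

Theorem tw_acyclic (tau : expo) p i (f : seq cell -> tw) :
  (forall b, step_coef i b != 0) -> tau i != 0%N ->
  (forall s, tw_grading tau (tot s) (f s)) ->
  (forall s, size s = p.+1 -> delta f s = 0) -> bar_cobound p f.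
Proof.
move=> kap0 ti gf cf; apply: phi_injective => //; exists (twhtpy i (phi p f)) => a.
rewrite (twhtpy_id (tau := tau)) // => b.
  by apply: phi_gr => //; apply: tw_graded.
rewrite -phi_delta // (phi_eq (g := fun s => f s - f s)) ?phiB ?subrr //.
by move=> s ss; rewrite cf // subrr.
Qed.

(** Here t + wt a = 0 forces a = 0, so [phi f] vanishes in positive degree. *)
Theorem tw_socle p (f : seq cell -> tw) :
  (forall s, tw_grading 0 (tot s) (f s)) ->
  (forall s, size s = p.+2 -> delta f s = 0) -> bar_cobound p.+1 f.
Proof.
move=> gf cf; apply: phi_injective => //; exists (fun=> 0) => a.
transitivity (0 : tw); last first.
  by rewrite /kdiff big1 // => i _; rewrite /kdiff_dir; case: eqP => // _; rewrite !raddf0.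
case: (eqVneq (deg a) p.+1) => [da|/(phi_supp f)//].
apply: ext_inj => t _; rewrite ext0.
have H : tw_grading 0 (wt m a) (phi p.+1 f a) by apply: phi_gr => //; apply: tw_graded.
apply: H; apply: contraTN isT; rewrite addE_eq0 => /andP[_ /eqP w0].
suff a0 : a = 0 by rewrite a0 deg0 in da.
apply/ffunP=> i; rewrite zeroEE; move/eqP: (congr1 (fun c : expo => c i) w0).
rewrite ffunE zeroEE addn_eq0 muln_eq0 (gtn_eqF (m0 i)) /= => /andP[/eqP h /eqP o].
by rewrite -(odd_double_half (a i)) h o.
Qed.
End Module.

(** * Multidegree 0: detecting the products of the V_i *)

Definition top : expo := [ffun i => (m i).-1].
Definition ind (S : {set 'I_n}) : expo := [ffun i => (i \in S : nat)].

Lemma box_top : box m top.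
Proof. by apply/boxP=> i; rewrite ffunE; have := m0 i; lia. Qed.

Fixpoint wprod (l : seq 'I_n) (s : seq cell) : k :=
  match l, s with
  | [::], [::] => 1
  | i :: l', c :: s' => (cexp c i)%:R * wprod l' s'
  | _, _ => 0
  end.

(* The cochain V_{l_1} ... V_{l_p}, with values multiplied by x^w. *)
Definition wcoch (l : seq 'I_n) (w : expo) (s : seq cell) : W :=
  [ffun t => if cexp t + w + tot s == top then wprod l s else 0].

Lemma ext_wcoch l w s t : ext t (wcoch l w s) = if t + w + tot s == top then wprod l s else 0.
Proof.
apply: (@ext_ffun _ m k (fun t => if t + w + tot s == top then wprod l s else 0)).
move=> c nb; case: eqP => // e; case/negP: nb; apply: (@box_addl _ _ c (w + tot s)).
by rewrite addrA e box_top.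
Qed.

Local Notation M := (tw [ffun=> 1]).

Lemma step_coef1 i : step_coef [ffun=> 1] i true = 0 :> k.
Proof. by rewrite /step_coef ffunE subrr. Qed.

(** Fixing the first argument x^u contributes the factor u_j and the monomial x^u; the parameter w
    of [wcoch] absorbs the latter, which closes the induction in [phi_wcoch]. *)
Lemma ext_lead_wcoch j l w u s :
  ext u (lead (V := M) (wcoch (j :: l) w) s) = scl (u j)%:R (wcoch l (w + u) s).
Proof.
pose g (u : expo) := scl (u j)%:R (wcoch l (w + u) s).
rewrite -[RHS]/(g u) -(@ext_ffun _ m _ g).
  congr (ext _ _); apply/ffunP=> c; rewrite !ffunE; apply: ext_inj => t _.
  rewrite ext_scl !ext_wcoch /= /tot big_cons -/(tot s) !addrA.
  by case: eqP; rewrite ?mulr0.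
move=> c nb; apply: ext_inj => t _; rewrite ext_scl ext_wcoch ext0.
case: eqP => [e|_]; last by rewrite mulr0.
case/negP: nb; apply: (@box_addl _ _ c (t + w + tot s)).
rewrite [X in box m X](_ : _ = top) ?box_top // -e addrA [c + _]addrC.
by rewrite [t + (w + c)]addrA.
Qed.

Lemma phi_wcoch l w (a : expo) : sorted (fun i j : 'I_n => (i < j)%N) l ->
  (forall i, a i <= 1)%N ->
  phi (V := M) (size l) (wcoch l w) a =
  if a == \sum_(j <- l) unit_at j 1
  then [ffun t => if cexp t + w + a == top then 1 else 0] else 0.
Proof.
elim: l w a => [|j l IH] w a sl a1.
  rewrite phi0 big_nil; case: eqP => // ->.
  by apply/ffunP=> t; rewrite !ffunE /= /tot big_nil.
have sl' : sorted (fun i j : 'I_n => (i < j)%N) l by move: sl => /=; apply: path_sorted.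
have lj : forall i, i \in l -> (j < i)%N.
  apply/allP; move: sl; rewrite /= path_sortedE => [/andP[]//|x y z].
  exact: ltn_trans.
rewrite /= phiS /kdiff ext_sum.
(* Every a_i is at most 1, so only x_i - y_i occurs. The y_i part sees the curried cochain at
   exponent 0 and gives 0; the x_i part sees it at x_i and gives the factor (i == j). *)
have term i : ext 0 (kdiff_dir i (phi (size l) (lead (V := M) (wcoch (j :: l) w))) a) =
    if (i == j) && (a j == 1%N)
    then signed (koszul_sign j a) (phi (V := M) (size l) (wcoch l (w + unit_at j 1)) (pred_at a
      j)) else 0.
  rewrite /kdiff_dir; case: eqP => [ai|/eqP ai].
    by rewrite ext0; case: eqP => [<-|//]; rewrite ai.
  have -> : odd (a i) = true by move: (a1 i) ai; case: (a i) => [|[]].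
  have -> : forall G : coind M, ext 0 (signed (koszul_sign i a) (step i true G)) =
      signed (koszul_sign i a) (ext (unit_at i 1) G - ract (unit_at i 1) (ext 0 G)).
    by move=> G; rewrite -[unit_at i 1 in X in X - _]add0r -ext_step_odd; apply: raddf_signed.
  have ph u : ext u (phi (size l) (lead (V := M) (wcoch (j :: l) w)) (pred_at a i)) =
      scl (u j)%:R (phi (V := M) (size l) (wcoch l (w + u)) (pred_at a i)).
    rewrite -(@phi_nat _ _ _ (coind M) M (@ext n m M u)); last exact: ext_rmor.
    rewrite -(@phi_nat _ _ _ M M (@scl (u j)%:R)).
      by apply: phi_eq => s _; apply: ext_lead_wcoch.
    by move=> c v; apply: ext_inj => t _; rewrite /= !(ext_scl, ext_shiftI).
  rewrite !ph zeroEE unit_atE eq_sym.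
  have s0 v : scl 0 v = 0 by apply/ffunP=> t; rewrite !ffunE mul0r.
  have s1 v : scl 1 v = v by apply/ffunP=> t; rewrite !ffunE mul1r.
  rewrite mulr0n s0 raddf0 subr0; case: eqP => [e|_]; last by rewrite mulr0n s0 raddf0.
  by subst j; rewrite mulr1n s1 (_ : a i == 1%N) //; move: (a1 i) ai; case: (a i) => [|[]].
rewrite (eq_bigr _ (fun i _ => term i)) (bigD1 j) //= big1 ?addr0; last first.
  by move=> i /negPf ->.
rewrite eqxx big_cons /=.
case: eqP => aj; last first.
  case: eqP => // e; case: aj; apply/eqP; rewrite eqn_leq a1 e addEE unit_atE eqxx.
  by rewrite leq_addr.
rewrite IH // => [|i]; last by rewrite pred_atE; case: eqP => _; rewrite // aj.
have aj0 : a j != 0%N by rewrite aj.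
have -> : (a == unit_at j 1 + \sum_(j0 <- l) unit_at j0 1) =
    (pred_at a j == \sum_(j0 <- l) unit_at j0 1).
  rewrite -[a in LHS](up_pred aj0) addrC.
  by apply/eqP/eqP => [/addE_injl|-> //].
case: eqP => [e|_]; last by rewrite raddf0.
(* As l is increasing, j precedes every other index at which a is nonzero. *)
have -> : koszul_sign j a = false.
  rewrite -(up_pred aj0) koszul_sign_up ltnn addFb /koszul_sign big1 // => i ij.
  rewrite e sum_ffunE big1_seq // => x /andP[_ xl]; rewrite unit_atE.
  by case: eqP => // ix; have := lj _ xl; rewrite -ix ltnNge ltnW.
apply/ffunP=> t; rewrite /signed !ffunE -!addrA; congr (if _ + (_ + _) == _ then _ else _).
by rewrite addrC up_pred.
Qed.

Definition cotop (S : {set 'I_n}) : expo := [ffun i => (m i).-1 - (i \in S)]%N.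

Lemma cotopK (S : {set 'I_n}) : cotop S + ind S = top.
Proof.
apply/ffunP=> i; rewrite addEE !ffunE; have := m2 i.
by case: (i \in S) => /=; lia.
Qed.

Lemma ind_le1 (S : {set 'I_n}) i : (ind S i <= 1)%N.
Proof. by rewrite ffunE; case: (i \in S). Qed.

Lemma sum_enum_ind (S : {set 'I_n}) : \sum_(j <- enum S) unit_at j 1 = ind S.
Proof.
apply/ffunP=> i; rewrite sum_ffunE ffunE big_enum /=.
case: (boolP (i \in S)) => iS.
  rewrite (bigD1 i) //= unit_atE eqxx big1 ?addn0 // => j /andP[_ /negPf ji].
  by rewrite unit_atE eq_sym ji.
rewrite big1 // => j jS; rewrite unit_atE; case: eqP => // e.
by rewrite e jS in iS.
Qed.

Lemma deg_ind (S : {set 'I_n}) : deg (ind S) = #|S|.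
Proof.
rewrite /deg -sum1_card [RHS]big_mkcond; apply: eq_bigr => i _.
by rewrite ffunE; case: (i \in S).
Qed.

Lemma ind_inj : injective ind.
Proof.
move=> S S' /ffunP e; apply/setP=> i; have := e i; rewrite !ffunE.
by case: (i \in S); case: (i \in S').
Qed.

Lemma sorted_enum (S : {set 'I_n}) : sorted (fun i j : 'I_n => (i < j)%N) (enum S).
Proof.
have tr : transitive (fun i j : 'I_n => (i < j)%N) by move=> x y z; apply: ltn_trans.
rewrite {1}/enum_mem; apply: sorted_filter => //; rewrite -enumT.
have := iota_ltn_sorted 0 n; rewrite -val_enum_ord sorted_map.
by apply: sub_sorted.
Qed.

(** Reading the coefficient of x^(ind S') at index [ind S'] gives functionals dual to the V_S;
    [cotop S'] is the complementary exponent. *)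
Lemma phi_wcoch_ind (S S' : {set 'I_n}) :
  ext (cotop S') (phi (V := M) #|S| (wcoch (enum S) 0) (ind S')) = (S == S')%:R.
Proof.
rewrite cardE phi_wcoch; [|exact: sorted_enum|exact: ind_le1].
rewrite sum_enum_ind (inj_eq ind_inj) [S == S']eq_sym; case: eqP => [->|_]; last by rewrite ext0.
have -> : [ffun t : cell => if cexp t + 0 + ind S == top then 1 : k else 0] =
    [ffun t => (cexp t + ind S == top)%:R].
  by apply/ffunP=> t; rewrite !ffunE addr0; case: eqP.
rewrite (@ext_ffun _ m _ (fun c => (c + ind S == top)%:R)) ?cotopK ?eqxx //.
by move=> c nb; case: eqP => // e; case/negP: nb; apply: (@box_addl _ _ c (ind S));
  rewrite e box_top.
Qed.

(** For the trivial character x_i - y_i acts as 0, and no other differential enters an index with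
    entries 0 and 1. The dual functionals therefore descend to cohomology. *)
Lemma phi_delta_ind p (h : seq cell -> M) S : phi (V := M) p.+1 (delta h) (ind S) = 0.
Proof.
rewrite phi_delta // /kdiff big1 // => i _; rewrite /kdiff_dir; case: eqP => // /eqP.
rewrite ffunE; case: (i \in S) => //= _.
set v := phi _ _ _; have -> : step i true v = 0; last by rewrite raddf0.
by apply: ext_inj => t _; rewrite ext_step step_coef1 mul0r ext0.
Qed.

Theorem tw_top p (f : seq cell -> M) :
  (forall s, tw_grading top (tot s) (f s)) ->
  (forall s, size s = p.+1 -> delta f s = 0) ->
  (forall S : {set 'I_n}, #|S| = p -> ext (cotop S) (phi p f (ind S)) = 0) ->
  bar_cobound p f.
Proof.
move=> gf cf fS; apply: phi_injective => //; exists (fun=> 0) => a.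
transitivity (0 : M); last first.
  by rewrite /kdiff big1 // => i _; rewrite /kdiff_dir; case: eqP => // _; rewrite !raddf0.
case: (eqVneq (deg a) p) => [da|/(phi_supp f)//].
have H : tw_grading top (wt m a) (phi p f a) by apply: phi_gr => //; apply: tw_graded.
apply: ext_inj => t _; rewrite ext0; case: (eqVneq (t + wt m a) top) => [e|/H//].
(* An entry a_i >= 2 would have weight at least m_i, more than top allows. *)
have a1 i : (a i <= 1)%N.
  rewrite leqNgt; apply/negP=> a2; have := congr1 (fun c : expo => c i) e.
  rewrite addEE !ffunE; have := m0 i.
  have : (m i <= m i * (a i)./2)%N by rewrite leq_pmulr // half_gt0.
  move=> le mi ee; have : (m i <= (m i).-1)%N.
    by rewrite -ee addnCA; apply: leq_trans le (leq_addr _ _).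
  by rewrite leqNgt prednK // leqnn.
pose S := [set i | a i == 1%N].
have aS : a = ind S.
  by apply/ffunP=> i; rewrite ffunE inE; move: (a1 i); case: (a i) => [|[]].
have wS : wt m a = a.
  by apply/ffunP=> i; rewrite ffunE; move: (a1 i); case: (a i) => [|[|//]] //=; rewrite muln0.
have -> : t = cotop S.
  apply: (addE_injl (c := ind S)); rewrite addrC -aS -{1}wS e.
  by rewrite -(cotopK S) addrC -aS.
by rewrite aS fS // -deg_ind -aS.
Qed.
End Twisted.

(** * The monomial basis *)

Section Monomials.
Variables (k : fieldType) (n : nat) (m : 'I_n -> nat) (q : 'I_n -> 'I_n -> k).
Hypothesis m0 : forall i, (0 < m i)%N.
Hypothesis q0 : forall i j : 'I_n, (i < j)%N -> q i j != 0.
Local Notation cell := (@cell n m).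
Local Notation expo := (@expo n).

Definition zexpo := {ffun 'I_n -> int}.
Definition zexp (c : expo) : zexpo := [ffun i => (c i)%:Z].

Lemma zexpD c c' : zexp (c + c') = zexp c + zexp c'.
Proof. by apply/ffunP=> i; rewrite ffunE addEE PoszD [RHS]ffunE !ffunE. Qed.
Lemma zexp0 : zexp 0 = 0.
Proof. by apply/ffunP=> i; rewrite [RHS]ffunE !ffunE. Qed.

(* x^w x^w' = theta w w' x^(w + w') in the quantum torus. *)
Definition theta (w w' : zexpo) : k :=
  \prod_(i < n) \prod_(j < n | (i < j)%N) q i j ^ (w j * w' i).

Lemma theta_neq0 w w' : theta w w' != 0.
Proof.
apply/prodf_neq0 => i _; apply/prodf_neq0 => j ij.
by rewrite expfz_neq0 ?q0.
Qed.
Lemma thetaDl w w' u : theta (w + w') u = theta w u * theta w' u.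
Proof.
rewrite /theta -big_split; apply: eq_bigr => i _; rewrite -big_split.
by apply: eq_bigr => j ij; rewrite ffunE mulrDl expfzDr ?q0.
Qed.
Lemma thetaDr w u u' : theta w (u + u') = theta w u * theta w u'.
Proof.
rewrite /theta -big_split; apply: eq_bigr => i _; rewrite -big_split.
by apply: eq_bigr => j ij; rewrite ffunE mulrDr expfzDr ?q0.
Qed.
Lemma theta0l w : theta 0 w = 1.
Proof.
by rewrite /theta big1 // => i _; rewrite big1 // => j _; rewrite ffunE mul0r expr0z.
Qed.
Lemma theta0r w : theta w 0 = 1.
Proof.
by rewrite /theta big1 // => i _; rewrite big1 // => j _; rewrite ffunE mulr0 expr0z.
Qed.

Lemma theta_unit (i j : 'I_n) : (i < j)%N -> theta (zexp (unit_at j 1)) (zexp (unit_at i 1)) =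
  q i j.
Proof.
move=> ij; rewrite /theta (bigD1 i) //= (bigD1 j) //= !ffunE !eqxx mulr1 expr1z.
rewrite big1 ?mulr1 => [|l /andP[_ /negPf lj]]; last first.
  by rewrite !ffunE lj mul0r expr0z.
rewrite big1 ?mulr1 // => l /negPf li.
by rewrite big1 // => j' _; rewrite !ffunE li mulr0 expr0z.
Qed.
Lemma theta_unit_le (i j : 'I_n) : (j <= i)%N -> theta (zexp (unit_at j 1)) (zexp (unit_at i
  1)) = 1.
Proof.
move=> ji; rewrite /theta big1 // => i' _; rewrite big1 // => j' ij; rewrite !ffunE.
case: (eqVneq j' j) => [e|]; last by rewrite mul0r expr0z.
case: (eqVneq i' i) => [e'|]; last by rewrite mulr0 expr0z.
by rewrite e e' ltnNge ji in ij.
Qed.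

Lemma sorted_enumT : sorted (fun i j : 'I_n => (i < j)%N) (enum 'I_n).
Proof.
have := iota_ltn_sorted 0 n; rewrite -val_enum_ord sorted_map.
by apply: sub_sorted.
Qed.

Section Algebra.
Variables (A : algType k) (x : 'I_n -> A).
Hypothesis rel : qci_relations m q x.

Definition pmon (s : seq 'I_n) (c : expo) : A := \prod_(i <- s) x i ^+ c i.
Definition mon := pmon (enum 'I_n).

Lemma x_comm (i j : 'I_n) a b : (i < j)%N ->
  x j ^+ a * x i ^+ b = q i j ^+ (a * b) *: (x i ^+ b * x j ^+ a).
Proof.
move=> ij; have xx b' : x j * x i ^+ b' = q i j ^+ b' *: (x i ^+ b' * x j).
  elim: b' => [|b' IH]; first by rewrite !expr0 scale1r mulr1 mul1r.
  rewrite exprS mulrA (rel.2 _ _ ij) -scalerAl -[x i * x j * _]mulrA IH -scalerAr scalerA mulrA.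
  by rewrite [q i j ^+ _.+1]exprS.
elim: a => [|a IH]; first by rewrite mul0n !expr0 scale1r mulr1 mul1r.
rewrite exprS -[x j * _ * _]mulrA IH -scalerAr [x j * (_ * _)]mulrA xx -scalerAl scalerA.
by rewrite -[x i ^+ b * _ * _]mulrA mulSn exprD mulrC.
Qed.

Lemma pmon_cons i s c : pmon (i :: s) c = x i ^+ c i * pmon s c.
Proof. exact: big_cons. Qed.

Lemma pmon_comm (i : 'I_n) (s : seq 'I_n) (c : expo) b : (forall j, j \in s -> (i < j)%N) ->
  pmon s c * x i ^+ b = (\prod_(j <- s) q i j ^+ (c j * b)) *: (x i ^+ b * pmon s c).
Proof.
elim: s => [|j s IH] lt; first by rewrite /pmon !big_nil scale1r mulr1 mul1r.
rewrite pmon_cons -mulrA IH => [|l ls]; last by apply: lt; rewrite in_cons ls orbT.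
rewrite -scalerAr !mulrA (@x_comm i j); last by apply: lt; rewrite mem_head.
by rewrite -scalerAl scalerA big_cons mulrC.
Qed.

Lemma pmon_mul (s : seq 'I_n) (c c' : expo) : sorted (fun i j : 'I_n => (i < j)%N) s ->
  pmon s c * pmon s c' =
  (\prod_(i <- s) \prod_(j <- s | (i < j)%N) q i j ^+ (c j * c' i)) *: pmon s (c + c').
Proof.
elim: s => [|i s IH] ss; first by rewrite /pmon !big_nil scale1r mulr1.
have lt : forall j, j \in s -> (i < j)%N.
  apply/allP; move: ss; rewrite /= path_sortedE => [/andP[]//|a b d].
  exact: ltn_trans.
rewrite !pmon_cons mulrA -[_ * pmon s c * _]mulrA pmon_comm // -scalerAr -scalerAl.
rewrite mulrA -exprD -mulrA IH; last exact: path_sorted ss.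
rewrite -scalerAr scalerA addEE big_cons; congr (_ * _ *: _).
  rewrite [in RHS]big_cons ltnn big_seq [RHS]big_seq_cond.
  by apply: eq_bigl => j; case: (boolP (j \in s)) => // /lt ->.
rewrite !big_seq; apply: eq_bigr => j js; rewrite big_cons.
by rewrite ltnNge ltnW ?lt.
Qed.

Lemma mon_mul c c' : mon c * mon c' = theta (zexp c) (zexp c') *: mon (c + c').
Proof.
rewrite /mon pmon_mul ?sorted_enumT //; congr (_ *: _).
rewrite /theta big_enum; apply: eq_bigr => i _.
by rewrite big_enum_cond; apply: eq_bigr => j _; rewrite !ffunE -PoszM.
Qed.

Lemma mon_out c : ~~ box m c -> mon c = 0.
Proof.
move=> /forallPn[i]; rewrite -leqNgt => mi.
have xi : x i ^+ c i = 0 by rewrite -(subnK mi) exprD rel.1 mulr0.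
rewrite /mon; have : i \in enum 'I_n by rewrite mem_enum.
elim: (enum 'I_n) => // j s IH; rewrite in_cons pmon_cons => /orP[/eqP <-|/IH ->].
  by rewrite xi mul0r.
by rewrite mulr0.
Qed.

Lemma mon0 : mon 0 = 1.
Proof. by rewrite /mon /pmon big1 // => i _; rewrite zeroEE expr0. Qed.

Lemma mon_unit i : mon (unit_at i 1) = x i.
Proof.
rewrite /mon /pmon (eq_bigr (fun j => if j == i then x j else 1)); last first.
  by move=> j _; rewrite unit_atE; case: eqP.
have : uniq (enum 'I_n) by apply: enum_uniq.
have : i \in enum 'I_n by rewrite mem_enum.
elim: (enum 'I_n) => // j s IH; rewrite in_cons /= big_cons => /orP[/eqP <-|is_] /andP[js us].
  rewrite eqxx big_seq big1 ?mulr1 // => l ls.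
  by case: eqP => // e; rewrite -e ls in js.
rewrite IH //; case: eqP => [e|_]; last by rewrite mul1r.
by rewrite e is_ in js.
Qed.

Lemma mon_span : alg_generated x ->
  forall a, exists al : cell -> k, a = \sum_t al t *: mon (cexp t).
Proof.
move=> gen; have basis c : exists al : cell -> k, mon c = \sum_t al t *: mon (cexp t).
  case: (boolP (box m c)) => [/box_cell[t ->]|/mon_out ->].
    exists (fun u => (u == t)%:R); rewrite (bigD1 t) //= eqxx scale1r big1 ?addr0 //.
    by move=> u /negPf ->; rewrite scale0r.
  by exists (fun=> 0); rewrite big1 // => t _; rewrite scale0r.
have addP (a b : A) : (exists al : cell -> k, a = \sum_t al t *: mon (cexp t)) ->
    (exists al : cell -> k, b = \sum_t al t *: mon (cexp t)) ->
    exists al : cell -> k, a + b = \sum_t al t *: mon (cexp t).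
  move=> [al ->] [be ->]; exists (fun t => al t + be t); rewrite -big_split.
  by apply: eq_bigr => t _; rewrite scalerDl.
have sclP (d : k) (a : A) : (exists al : cell -> k, a = \sum_t al t *: mon (cexp t)) ->
    exists al : cell -> k, d *: a = \sum_t al t *: mon (cexp t).
  move=> [al ->]; exists (fun t => d * al t); rewrite scaler_sumr.
  by apply: eq_bigr => t _; rewrite scalerA.
have sumP (I : Type) (r : seq I) (F : I -> A) :
    (forall i, exists al : cell -> k, F i = \sum_t al t *: mon (cexp t)) ->
    exists al : cell -> k, \sum_(i <- r) F i = \sum_t al t *: mon (cexp t).
  move=> Fi; elim: r => [|i r IH]; last by rewrite big_cons; apply: addP.
  by rewrite big_nil; exists (fun=> 0); rewrite big1 // => t _; rewrite scale0r.
apply: gen => //; first by rewrite -mon0.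
  by move=> i; rewrite -mon_unit.
move=> a b [al ->] [be ->]; rewrite mulr_suml; apply: (sumP) => t.
rewrite mulr_sumr; apply: sumP => u.
by rewrite -scalerAl -scalerAr mon_mul !scalerA; apply: sclP.
Qed.
End Algebra.

(* A model of the relations in which the monomials are linearly independent. *)
Section Model.
Variables (N : nat) (cardE : #|{: cell}| = N.+1).
Local Notation idx t := (cast_ord cardE (enum_rank t)).
Local Notation inv r := (enum_val (cast_ord (esym cardE) r)).

Lemma idxK t : inv (idx t) = t.
Proof. by rewrite cast_ordK enum_rankK. Qed.

(** Left multiplication by x_i on the expected monomial basis, with the structure constants that
    [mon_mul] predicts. *)
Definition ymat (i : 'I_n) : 'M[k]_N.+1 := \matrix_(r, s)
  if cexp (inv r) == cexp (inv s) + unit_at i 1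
  then theta (zexp (unit_at i 1)) (zexp (cexp (inv s))) else 0.

Definition evec (c : expo) : 'cV[k]_N.+1 := \col_r (cexp (inv r) == c)%:R.

Lemma evec_out c : ~~ box m c -> evec c = 0.
Proof.
move=> nb; apply/matrixP=> r z; rewrite !mxE; case: eqP => // e.
by rewrite -e box_cexp in nb.
Qed.

Lemma evec_cexp t : evec (cexp t) = delta_mx (idx t) 0.
Proof.
apply/matrixP=> r z; rewrite !mxE ord1 eqxx andbT (inj_eq (@cexp_inj _ _)).
congr (_%:R); congr nat_of_bool; apply/eqP/eqP => [<-|->]; last by rewrite idxK.
by rewrite enum_valK cast_ordKV.
Qed.

Lemma ymat_evec i c : ymat i *m evec c =
  theta (zexp (unit_at i 1)) (zexp c) *: evec (c + unit_at i 1).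
Proof.
case: (boolP (box m c)) => [/box_cell[t ->]|nb]; last first.
  rewrite !evec_out ?mulmx0 ?scaler0 //; apply: contra nb; exact: box_addl.
rewrite evec_cexp -colE; apply/matrixP=> r z; rewrite !mxE idxK.
by case: eqP; rewrite ?mulr1 ?mulr0.
Qed.

Lemma evec_faithful (B C : 'M[k]_N.+1) : (forall c, B *m evec c = C *m evec c) -> B = C.
Proof.
move=> e; apply/matrixP=> r s; have /matrixP/(_ r 0) := e (cexp (inv s)).
rewrite evec_cexp -!colE !mxE.
by rewrite (_ : idx _ = s) // enum_valK cast_ordKV.
Qed.

Lemma ymat_pow i p c : exists2 a : k, a != 0 &
  (ymat i ^+ p) *m evec c = a *: evec (c + unit_at i p).
Proof.
elim: p => [|p [a a0 IH]].
  by exists 1; rewrite ?oner_eq0 // expr0 mul1mx scale1r unit_at0 addr0.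
exists (a * theta (zexp (unit_at i 1)) (zexp (c + unit_at i p))).
  by rewrite mulf_neq0 // theta_neq0.
by rewrite exprS -mulmxE -mulmxA IH -scalemxAr ymat_evec scalerA -addrA -unit_atD addn1.
Qed.

Lemma ymat_rel : qci_relations m q ymat.
Proof.
split=> [i|i j ij]; apply: evec_faithful => c.
  have [a _ ->] := ymat_pow i (m i) c; rewrite mul0mx evec_out ?scaler0 //.
  by apply/boxP=> /(_ i); rewrite addEE unit_atE eqxx ltnNge leq_addl.
rewrite -scalemxAl -!mulmxE -!mulmxA !ymat_evec -!scalemxAr !ymat_evec !scalerA.
rewrite -!addrA [unit_at j 1 + _]addrC !zexpD !thetaDr theta_unit // theta_unit_le 1?ltnW //.
by congr (_ *: _); ring.
Qed.

Lemma pmon_evec0 s (c : expo) : exists2 a : k, a != 0 &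
  pmon ymat s c *m evec 0 = a *: evec (\sum_(i <- s) unit_at i (c i)).
Proof.
elim: s => [|i s [a a0 IH]].
  by exists 1; rewrite ?oner_eq0 // /pmon !big_nil mul1mx scale1r.
have [b b0 e] := ymat_pow i (c i) (\sum_(j <- s) unit_at j (c j)).
exists (a * b); first by rewrite mulf_neq0.
by rewrite pmon_cons -mulmxE -mulmxA IH -scalemxAr e scalerA big_cons addrC.
Qed.
End Model.

Lemma sum_unit_at (c : expo) : \sum_(i <- enum 'I_n) unit_at i (c i) = c.
Proof.
apply/ffunP=> j; rewrite sum_ffunE big_enum /= (bigD1 j) //= unit_atE eqxx big1.
  by rewrite -[RHS]addn0.
by move=> i /negPf ij; rewrite unit_atE eq_sym ij.
Qed.

(** Generation gives spanning. For independence, the universal property maps A to the matrix model,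
    where the monomials send the vector of exponent 0 to nonzero multiples of distinct basis
    vectors; [coef] reads these off and divides by the multiple. *)
Theorem monomial_basis (A : algType k) (x : 'I_n -> A) : is_qci_presentation m q x ->
  exists coef : cell -> A -> k,
    [/\ forall t a u v, coef t (a *: u + v) = a * coef t u + coef t v,
        forall t c, coef t (mon x c) = (cexp t == c)%:R &
        forall a, a = \sum_t coef t a *: mon x (cexp t)].
Proof.
case=> rel gen univ.
have [N cardE] : exists N, #|{: cell}| = N.+1.
  by exists #|{: cell}|.-1; rewrite prednK //; apply/card_gt0P; exists [ffun i => Ordinal (m0 i)].
have [f [flin [f1 fM] fx]] := univ _ _ (ymat_rel cardE).
have fmon s c : f (pmon x s c) = pmon (ymat cardE) s c.
  elim: s => [|i s IH]; first by rewrite /pmon !big_nil.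
  rewrite !pmon_cons fM IH; congr (_ * _).
  by elim: (c i) => [|p IHp]; rewrite ?expr0 // !exprS fM IHp fx.
have sc (t : cell) : exists2 a : k, a != 0 & f (mon x (cexp t)) *m evec cardE 0 = a *: evec
  cardE (cexp t).
  by rewrite fmon; have [a a0 e] := pmon_evec0 cardE (enum 'I_n) (cexp t);
    exists a => //; rewrite e sum_unit_at.
have [scal_ scal0 scalE] := fin_all_exists2 sc.
pose coef (t : cell) a := (scal_ t)^-1 * (f a *m evec cardE 0) (cast_ord cardE (enum_rank t)) 0.
have f0 : f 0 = 0 by have := flin (-1) 0 0; rewrite scaler0 addr0 => ->; rewrite scaleN1r addNr.
have clin t a u v : coef t (a *: u + v) = a * coef t u + coef t v.
  by rewrite /coef flin mulmxDl -scalemxAl !mxE mulrDr mulrCA.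
have cmon t c : coef t (mon x c) = (cexp t == c)%:R.
  case: (boolP (box m c)) => [/box_cell[u ->]|nb].
    rewrite /coef scalE !mxE idxK; case: eqP => [/cexp_inj ->|_]; rewrite ?mulr0 // mulr1.
    by rewrite mulVf.
  rewrite mon_out // /coef f0 mul0mx mxE mulr0; case: eqP => // e.
  by rewrite -e box_cexp in nb.
exists coef; split=> // a.
have c0 t : coef t 0 = 0 by rewrite /coef f0 mul0mx mxE mulr0.
have [al ->] := mon_span rel gen a; apply: eq_bigr => t _; congr (_ *: _).
have -> : coef t (\sum_u al u *: mon x (cexp u)) = \sum_u al u * coef t (mon x (cexp u)).
  apply: (big_ind2 (fun (a : A) b => coef t a = b)) => [//|a1 b1 a2 b2 e1 e2|u _].
    by rewrite -[a1]scale1r clin mul1r e1 e2.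
  by rewrite -[_ *: _]addr0 clin c0 addr0.
rewrite (bigD1 t) //= cmon eqxx mulr1 big1 ?addr0 // => u ut.
by rewrite cmon (inj_eq (@cexp_inj _ _)) eq_sym (negPf ut) mulr0.
Qed.
End Monomials.

(** * Hochschild cochains of A *)

Section HochschildDifferential.
Variables (k : fieldType) (A : algType k).
Implicit Types (f g h : seq A -> A) (s t : seq A) (a b : A).

(** Recursive form of the Hochschild differential without its leftmost term, negated. It mirrors
    [delta_tail], so the two complexes can be compared by induction on the arguments. *)
Fixpoint hdiff_tail f s : A :=
  match s with
  | [::] => 0
  | a :: s1 =>
    match s1 with
    | [::] => f [::] * a
    | b :: s2 => f (a * b :: s2) - hdiff_tail (fun r => f (a :: r)) s1
    end
  end.
Lemma hdiff_tail1 f a : hdiff_tail f [:: a] = f [::] * a. Proof. by []. Qed.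
Lemma hdiff_tail2 f a b s : hdiff_tail f [:: a, b & s] = f (a * b :: s) - hdiff_tail (fun r =>
  f (a :: r)) (b :: s).
Proof. by []. Qed.
Arguments hdiff_tail : simpl never.

Lemma hdiff_cons f a s : hdiff f (a :: s) = a * f s - hdiff_tail f (a :: s).
Proof.
rewrite /hdiff -addrA; congr (_ + _).
elim: s a f => [|b s IH] a f.
  by rewrite hdiff_tail1 big_geq // add0r expr1 mulN1r.
have := IH b (fun r => f (a :: r)); rewrite hdiff_tail2 opprB => /eqP.
rewrite -eqr_oppLR => /eqP <-.
rewrite [in LHS]/= big_ltn // expr1 mulN1r [merge_at _ 1]/= -addrA addrC.
congr (_ - f _); last by rewrite /merge_at /= drop0.
rewrite /= opprD; congr (_ + _); last by rewrite exprS mulN1r mulNr.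
by rewrite big_add1 -sumrN; apply: eq_big_nat => -[|i] // _; rewrite exprS mulN1r mulNr.
Qed.

Lemma hdiff_tail_eq f g s : (forall r, (size r).+1 = size s -> f r = g r) -> hdiff_tail f s =
  hdiff_tail g s.
Proof.
elim: s f g => [|a [|b s] IH] f g e //; first by rewrite !hdiff_tail1 e.
by rewrite !hdiff_tail2 e // (IH _ (fun r => g (a :: r))) // => r er; apply: e; rewrite /= er.
Qed.

Lemma hdiff_tail_lin (c : k) f g s :
  hdiff_tail (fun r => c *: f r + g r) s = c *: hdiff_tail f s + hdiff_tail g s.
Proof.
elim: s f g => [|a [|b s] IH] f g; first by rewrite scaler0 addr0.
  by rewrite !hdiff_tail1 mulrDl scalerAl.
by rewrite !hdiff_tail2 IH scalerBr opprD addrACA.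
Qed.

Lemma hdiff_eq f g s : (forall r, (size r).+1 = size s -> f r = g r) -> s != [::] ->
  hdiff f s = hdiff g s.
Proof. by case: s => // a s e _; rewrite !hdiff_cons e // (hdiff_tail_eq e). Qed.

Lemma hdiff_lin (c : k) f g s : s != [::] ->
  hdiff (fun r => c *: f r + g r) s = c *: hdiff f s + hdiff g s.
Proof.
case: s => // a s _; rewrite !hdiff_cons hdiff_tail_lin mulrDr -scalerAr scalerBr opprD.
exact: addrACA.
Qed.

Lemma multilinear_cons p f a : multilinear p.+1 f -> multilinear p (fun s => f (a :: s)).
Proof. by move=> ml s t b c d e; apply: (ml (a :: s)); rewrite /= -e. Qed.

Lemma multilinear_hdiff_tail p f : multilinear p f -> multilinear p.+1 (hdiff_tail f).
Proof.
move=> ml s; elim: s p f ml => [|x [|y s] IH] p f ml t a b c [e]; subst p.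
- case: t => [|y t] in ml *; rewrite ?cat0s.
    by rewrite !hdiff_tail1 mulrDr -scalerAr.
  rewrite /= !hdiff_tail2 mulrDl -scalerAl (ml [::]) //=.
  have -> : hdiff_tail (fun r => f (c *: a + b :: r)) (y :: t) =
      hdiff_tail (fun r => c *: f (a :: r) + f (b :: r)) (y :: t).
    by apply: hdiff_tail_eq => r /= [er]; apply: (ml [::]); rewrite /= er.
  by rewrite hdiff_tail_lin scalerBr opprD addrACA.
- move: ml; rewrite add1n => ml; rewrite /= !hdiff_tail2 mulrDr -scalerAr (ml [::]) //=.
  rewrite (IH (size t) _ (multilinear_cons x ml) t) //=.
  by rewrite scalerBr opprD addrACA.
move: ml; rewrite /= => ml; rewrite !hdiff_tail2 (ml (x * y :: s)) /= -?addSn //.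
rewrite (IH _ _ (multilinear_cons x ml) t) //=.
by rewrite scalerBr opprD addrACA.
Qed.

Lemma multilinear_hdiff p f : multilinear p f -> multilinear p.+1 (hdiff f).
Proof.
move=> ml [|x s] t a b c e; have := multilinear_hdiff_tail ml (s := _) (t := t) a b c => rl.
  rewrite /= !hdiff_cons (rl [::] e) mulrDl scalerBr opprD addrACA.
  by rewrite scalerAl.
rewrite /= !hdiff_cons (rl (x :: s) e) ml; last by case: e => <-.
by rewrite mulrDr -scalerAr scalerBr opprD addrACA.
Qed.

Lemma multilinear_lin p (c : k) f g : multilinear p f -> multilinear p g ->
  multilinear p (fun s => c *: f s + g s).
Proof.
move=> mf mg s t a b d e; rewrite mf // mg // !scalerDr !scalerA mulrC -!addrA.
by congr (_ + _); rewrite addrCA.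
Qed.

Lemma cocycle_lin p (c : k) f g : cocycle p f -> cocycle p g ->
  cocycle p (fun s => c *: f s + g s).
Proof.
move=> [mf cf] [mg cg]; split; first exact: multilinear_lin.
move=> s ss; rewrite hdiff_lin ?cf ?cg ?scaler0 ?addr0 //.
by rewrite -size_eq0 ss.
Qed.

Lemma cocycle_ext p f g : (forall s, f s = g s) -> cocycle p f -> cocycle p g.
Proof.
move=> e [mf cf]; split=> [s t a b c st|s ss]; first by rewrite -!e mf.
by rewrite -(cf s ss); apply: hdiff_eq => // ; rewrite -size_eq0 ss.
Qed.

Lemma cocycle_zero p : cocycle p (fun=> 0 : A).
Proof.
split=> [s t a b c _|[|a s] // _]; first by rewrite scaler0 addr0.
rewrite hdiff_cons mulr0 (hdiff_tail_eq (g := fun=> 1 *: 0 + 0)) => [|r _]; last by rewrite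
  scale1r addr0.
by rewrite hdiff_tail_lin scale1r sub0r; apply/eqP; rewrite oppr_eq0; elim: s a => [|b s IH] a;
  rewrite ?hdiff_tail1 ?mul0r ?addr0 // !hdiff_tail2 sub0r -opprD oppr_eq0 IH.
Qed.

Lemma cocycle_sum p (I : Type) (r : seq I) (P : pred I) (c : I -> k) (F : I -> seq A -> A) :
  (forall i, P i -> cocycle p (F i)) ->
  cocycle p (fun s => \sum_(i <- r | P i) c i *: F i s).
Proof.
move=> cF; elim: r => [|i r IH].
  by apply: cocycle_ext (cocycle_zero p) => s; rewrite big_nil.
case Pi: (P i); last by apply: cocycle_ext IH => s; rewrite big_cons Pi.
by apply: cocycle_ext (cocycle_lin (c i) (cF i Pi) IH) => s; rewrite big_cons Pi.
Qed.

(** Beyond the first argument the differential acts on g alone; the cocycle conditions of d and g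
    make the remaining terms cancel. *)
Lemma cocycle_cup1 p (d : seq A -> A) g : cocycle 1 d -> cocycle p g ->
  cocycle p.+1 (cup 1 d g).
Proof.
move=> [md cd] [mg cg]; split.
  case=> [|x s] t a b c [st]; rewrite /cup /= ?take0 ?drop0.
    by rewrite (md [::] [::]) // mulrDl -scalerAl.
  by rewrite mg // mulrDr -scalerAr.
case=> [|a [|b s]] // [ss].
have rd : hdiff_tail (fun r => cup 1 d g (a :: r)) (b :: s) = d [:: a] * hdiff_tail g (b :: s).
  rewrite (hdiff_tail_eq (g := fun r => d [:: a] * g r)) => [|r _]; last first.
    by rewrite /cup /= take0 drop0.
  elim: (b :: s) g {mg cg} => [|x [|y r] IH] g; rewrite ?mulr0 ?hdiff_tail1 ?mulrA //.
  by rewrite !hdiff_tail2 IH mulrBr.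
rewrite hdiff_cons hdiff_tail2 rd /cup /= !take0 !drop0.
have := cg (b :: s); rewrite hdiff_cons => /(_ (congr1 S ss))/eqP.
rewrite subr_eq0 => /eqP <-; have := cd [:: a; b] erefl.
rewrite hdiff_cons hdiff_tail2 hdiff_tail1 opprB addrA => /eqP; rewrite subr_eq0 => /eqP e.
by rewrite opprB addrA !mulrA -mulrDl e subrr.
Qed.
End HochschildDifferential.
Arguments hdiff_tail : simpl never.

(** * From Hochschild cochains of A to twisted bar complexes *)

Section Untwist.
Variables (k : fieldType) (n : nat) (m : 'I_n -> nat) (q : 'I_n -> 'I_n -> k).
Hypothesis m2 : forall i, (1 < m i)%N.
Hypothesis q0 : forall i j : 'I_n, (i < j)%N -> q i j != 0.
Variables (A : algType k) (x : 'I_n -> A) (coef : @cell n m -> A -> k).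
Hypothesis rel : qci_relations m q x.
Hypothesis coef_lin : forall t a u v, coef t (a *: u + v) = a * coef t u + coef t v.
Hypothesis coef_mon : forall t c, coef t (mon x c) = (cexp t == c)%:R.
Hypothesis coef_sum : forall a, a = \sum_t coef t a *: mon x (cexp t).

Local Notation cell := (@cell n m).
Local Notation expo := (@expo n).
Local Notation mon := (mon x).
Local Notation theta := (theta q).
Local Notation top := (top m).
Local Notation W := ({ffun cell -> k}).

Let m0 i : (0 < m i)%N. Proof. exact: ltnW. Qed.

Lemma coefD t u v : coef t (u + v) = coef t u + coef t v.
Proof. by rewrite -{1}[u]scale1r coef_lin mul1r. Qed.
Lemma coef0 t : coef t 0 = 0.
Proof. by apply: (addrI (coef t 0)); rewrite -coefD !addr0. Qed.
Lemma coefZ t a u : coef t (a *: u) = a * coef t u.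
Proof. by rewrite -[a *: u]addr0 coef_lin coef0 addr0. Qed.

Definition compl (t : cell) : cell := [ffun i => rev_ord (t i)].
Lemma complK (t : cell) : cexp t + cexp (compl t) = top.
Proof.
apply/ffunP=> i; rewrite addEE !ffunE /=; have := ltn_ord (t i); lia.
Qed.

(* Coordinates of [a], indexed by the complementary exponents as in [tw]. *)
Definition coords (a : A) : W := [ffun t => coef (compl t) a].

Lemma coordsD a b : coords (a + b) = coords a + coords b.
Proof. by apply/ffunP=> t; rewrite !ffunE coefD. Qed.
Lemma coordsZ c a : coords (c *: a) = scl c (coords a).
Proof. by apply/ffunP=> t; rewrite !ffunE coefZ. Qed.
Lemma coords_is_additive : zmod_morphism coords.
Proof.
by move=> a b; apply/ffunP=> t; rewrite !ffunE coefD -scaleN1r coefZ mulN1r.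
Qed.
HB.instance Definition _ := GRing.isZmodMorphism.Build A W coords coords_is_additive.

Lemma coords_inj a b : coords a = coords b -> a = b.
Proof.
move=> /ffunP e; rewrite (coef_sum a) (coef_sum b); apply: eq_bigr => t _.
have <- : compl (compl t) = t by apply/ffunP=> i; rewrite !ffunE rev_ordK.
by have := e (compl t); rewrite !ffunE => ->.
Qed.

Lemma ext_coords_mon t c : ext t (coords (mon c)) = (t + c == top)%:R.
Proof.
rewrite -(@ext_ffun _ m _ (fun t => (t + c == top)%:R)).
  congr ext; apply/ffunP=> u; rewrite !ffunE coef_mon.
  congr (nat_of_bool _)%:R; rewrite -(complK u).
  by apply/eqP/eqP => [->//|/addE_injl].
move=> {}t nb; case: eqP => // e; case/negP: nb.
by apply: (@box_addl _ _ t c); rewrite e box_top.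
Qed.

Lemma zexp_top t c c' : t + c + c' = top -> zexp c' = zexp top - zexp t - zexp c.
Proof. by move=> <-; rewrite !zexpD; apply/ffunP=> i; rewrite !ffunE; ring. Qed.

(** The coordinate at t + c of a belongs to the monomial of exponent top - t - c. If that exponent
    has a negative entry, t + c is outside the box and both sides vanish, so integer exponents are
    safe. *)
Lemma ext_coords_monl t c a :
  ext t (coords (mon c * a)) = theta (zexp c) (zexp top - zexp t - zexp c) * ext (t + c)
    (coords a).
Proof.
rewrite (coef_sum a) mulr_sumr !raddf_sum /= mulr_sumr; apply: eq_bigr => u _.
rewrite -scalerAr (mon_mul rel) scalerA !coordsZ !ext_scl !ext_coords_mon addrA.
case: eqP => [/zexp_top <-|_]; last by rewrite !mulr0.
by rewrite !mulr1 mulrC.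
Qed.

Lemma ext_coords_monr t c a :
  ext t (coords (a * mon c)) = theta (zexp top - zexp t - zexp c) (zexp c) * ext (t + c)
    (coords a).
Proof.
rewrite (coef_sum a) mulr_suml !raddf_sum /= mulr_sumr; apply: eq_bigr => u _.
rewrite -scalerAl (mon_mul rel) scalerA !coordsZ !ext_scl !ext_coords_mon [_ + c]addrC addrA.
case: eqP => [/zexp_top <-|_]; last by rewrite !mulr0.
by rewrite !mulr1 mulrC.
Qed.

Definition mons (s : seq cell) : seq A := [seq mon (cexp c) | c <- s].

(* x^w x^{c_1} ... x^{c_p} = qfactor w [c_1; ...; c_p] x^{w + c_1 + ... + c_p}. *)
Fixpoint qfactor (w : @zexpo n) (s : seq cell) : k :=
  if s is c :: s' then theta w (zexp (cexp c)) * qfactor (w + zexp (cexp c)) s' else 1.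

Lemma qfactor_neq0 w s : qfactor w s != 0.
Proof. by elim: s w => [|c s IH] w /=; rewrite ?oner_eq0 // mulf_neq0 // theta_neq0. Qed.

Lemma tot_cons (c : cell) s : tot (c :: s) = cexp c + tot s.
Proof. exact: big_cons. Qed.
Lemma tot_nil : tot ([::] : seq cell) = 0.
Proof. exact: big_nil. Qed.

Lemma qfactor_add u w s : qfactor (u + w) s = theta u (zexp (tot s)) * qfactor w s.
Proof.
elim: s w => [|c s IH] w /=; first by rewrite tot_nil zexp0 theta0r mulr1.
by rewrite -addrA IH tot_cons zexpD thetaDl // thetaDr //; ring.
Qed.

(* x^c x^w = chi (lam w) c x^w x^c. *)
Definition lam (w : @zexpo n) : {ffun 'I_n -> k} :=
  [ffun i => theta (zexp (unit_at i 1)) w / theta w (zexp (unit_at i 1))].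

Lemma chi_lam w c : chi (lam w) c = theta (zexp c) w / theta w (zexp c).
Proof.
pose f (c : expo) := theta (zexp c) w / theta w (zexp c).
have fD c1 c2 : f (c1 + c2) = f c1 * f c2.
  by rewrite /f zexpD thetaDl // thetaDr // invfM; ring.
have f0 : f 0 = 1 by rewrite /f zexp0 theta0l theta0r divr1.
rewrite -/(f c) -{2}(sum_unit_at c) (big_morph f fD f0) big_enum /=.
apply: eq_bigr => i _; elim: (c i) => [|p IH]; first by rewrite unit_at0 f0 expr0.
by rewrite -addn1 unit_atD fD exprD IH expr1 ffunE.
Qed.

Section Key.
Variable mu : {ffun 'I_n -> k}.
Local Notation M := (tw m mu).

(** K and w accumulate for the induction: peeling off the argument x^c replaces w by w + c and K by
    K theta w c. *)
Lemma coords_hdiff_tail K w signed (G : seq A -> A) (h : seq cell -> M) p s t :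
  multilinear p G -> w + zexp signed = zexp top ->
  (forall r u, size r = p -> u + tot r = signed ->
     ext u (coords (G (mons r))) = K * qfactor w r * ext u (h r)) ->
  size s = p.+1 -> t + tot s = signed ->
  ext t (coords (hdiff_tail G (mons s))) = K * qfactor w s * ext t (delta_tail h s).
Proof.
elim: s p K w signed G h => [|c [|c' s] IH] p K w sigma G h // ml wE H [ss] ts.
  rewrite tot_cons tot_nil addr0 in ts; subst p.
  rewrite /= hdiff_tail1 delta_tail1 ext_coords_monr /= ext_shiftI (H [::]) ?tot_nil ?addr0 //.
  have -> : zexp top - zexp t - zexp (cexp c) = w.
    by rewrite -wE -ts zexpD; apply/ffunP=> i; rewrite !ffunE; ring.
  by rewrite !mulr1 mulrCA mulrA.
case: p => // p in ml H ss *; case: ss => ss.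
rewrite /= hdiff_tail2 delta_tail2 raddfB /= extB extB mulrBr; congr (_ - _).
  rewrite (mon_mul rel).
  have Gs (y : k) e : G ((y *: mon e) :: mons s) = y *: G (mon e :: mons s).
    have G0 : G (0 :: mons s) = 0.
      have := ml [::] (mons s) 0 0 1; rewrite /= size_map ss => /(_ erefl).
      rewrite scale1r addr0 scale1r => /eqP.
      by rewrite -subr_eq subrr eq_sym => /eqP.
    have := ml [::] (mons s) (mon e) 0 y; rewrite /= size_map ss => /(_ erefl).
    by rewrite !addr0 G0 addr0.
  rewrite Gs coordsZ ext_scl; case: (boolP (box m (cexp c + cexp c'))) => [|nb].
    move/box_cell=> [e ce]; rewrite ce ext_cexp ffunE.
    rewrite (H (e :: s)) //=; last 2 first.
    - by rewrite ss.
    - by rewrite tot_cons -ce -ts !tot_cons !addrA.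
    rewrite -ce !zexpD thetaDl // thetaDr // addrA; ring.
  rewrite (mon_out rel) // [ext (cexp c + _) _]ext_out // ext0 mulr0.
  have -> : G (0 :: mons s) = 0; last by rewrite raddf0 ext0 mulr0.
  by have := Gs 0 0; rewrite !scale0r.
transitivity (K * theta w (zexp (cexp c)) * qfactor (w + zexp (cexp c)) (c' :: s) *
  ext t (delta_tail (fun r => h (c :: r)) (c' :: s))); last by rewrite /=; ring.
apply: (IH p (K * theta w (zexp (cexp c))) _ (t + tot (c' :: s)) (fun r => G (mon (cexp c) ::
  r))) => //.
- exact: multilinear_cons.
- by rewrite -addrA -zexpD addrCA -tot_cons ts.
- move=> r u rp e; rewrite (H (c :: r)) /= ?rp // ?mulrA //.
  by rewrite tot_cons addrCA e addrCA -tot_cons.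
by rewrite /= ss.
Qed.
End Key.

(** Inner and right terms match after division by [qfactor], because w is inserted to the left of
    all arguments. In the leftmost term x^c stands before x^w, and moving it across produces the
    character [lam w]. *)
Lemma coords_hdiff tau w (G : seq A -> A) (h : seq cell -> W) p s t :
  multilinear p G -> w = zexp top - zexp tau ->
  (forall r u, size r = p -> u + tot r = tau ->
     ext u (coords (G (mons r))) = qfactor w r * ext u (h r)) ->
  size s = p.+1 -> t + tot s = tau ->
  ext t (coords (hdiff G (mons s))) = qfactor w s * ext t (delta (V := tw m (lam w)) h s).
Proof.
move=> ml wE H; case: s => // c s [ss] ts.
have wt : w + zexp tau = zexp top by rewrite wE subrK.
rewrite /= hdiff_cons raddfB /= extB extB mulrBr; congr (_ - _); last first.
  rewrite -[theta _ _ * _]mul1r; apply: (@coords_hdiff_tail (lam w) 1 w tau G h p (c :: s) t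
    ml) => //=.
    by move=> r u rp e; rewrite mul1r H.
  by rewrite ss.
rewrite ext_coords_monl ext_twX H //; last by rewrite -ts tot_cons addrA.
rewrite chi_lam [w + zexp (cexp c)]addrC qfactor_add.
have -> : zexp top - zexp t - zexp (cexp c) = w + zexp (tot s).
  rewrite -wt -ts tot_cons !zexpD; apply/ffunP=> i.
  by rewrite !ffunE; ring.
rewrite thetaDr //; field.
exact: theta_neq0.
Qed.

Lemma multilinear_sum p (f : seq A -> A) r t (I : Type) (l : seq I) (c : I -> k) (b : I -> A) :
  multilinear p f -> (size r + size t).+1 = p ->
  f (r ++ (\sum_(i <- l) c i *: b i) :: t) = \sum_(i <- l) c i *: f (r ++ b i :: t).
Proof.
move=> ml e; elim: l => [|i l IH]; last by rewrite !big_cons ml // IH.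
rewrite !big_nil; have := ml r t 0 0 1 e; rewrite !scale1r addr0 => /eqP.
by rewrite -subr_eq subrr eq_sym => /eqP.
Qed.

Lemma multilinear_ext p (f g : seq A -> A) : multilinear p f -> multilinear p g ->
  (forall s, size s = p -> f (mons s) = g (mons s)) ->
  forall s, size s = p -> f s = g s.
Proof.
move=> mf mg e s ss; rewrite -[s]cats0 -[[::]]/(mons [::]).
have : (size s + size ([::] : seq cell))%N = p by rewrite ss addn0.
(* Arbitrary elements precede a suffix of monomials; each step expands the last arbitrary one in the
   basis. *)
elim/last_ind: s {ss} [::] => [|s a IH] t et; first exact: e.
rewrite size_rcons addSn in et; rewrite cat_rcons (coef_sum a).
rewrite (multilinear_sum _ _ _ mf) ?size_map // (multilinear_sum _ _ _ mg) ?size_map //.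
apply: eq_bigr => c _; congr (_ *: _).
by apply: (IH (c :: t)); rewrite /= addnS.
Qed.

Fixpoint multiext (g : seq cell -> A) (s : seq A) : A :=
  if s is a :: s' then \sum_c coef c a *: multiext (fun r => g (c :: r)) s' else g [::].

Lemma multilinear_multiext p g : multilinear p (multiext g).
Proof.
move=> s t a b c _; elim: s g => [|d s IH] g /=.
  rewrite scaler_sumr -big_split; apply: eq_bigr => e _ /=.
  by rewrite coef_lin scalerDl scalerA.
rewrite scaler_sumr -big_split; apply: eq_bigr => e _ /=.
by rewrite IH scalerDr !scalerA mulrC.
Qed.

Lemma multiext_mons g s : multiext g (mons s) = g s.
Proof.
elim: s g => [|c s IH] g //=; rewrite (bigD1 c) //= coef_mon eqxx scale1r big1 ?addr0 ?IH //.
by move=> d dc; rewrite coef_mon (inj_eq (@cexp_inj _ _)) (negPf dc) scale0r.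
Qed.

Definition offset (tau : expo) : @zexpo n := zexp top - zexp tau.
Local Notation Mt tau := (tw m (lam (offset tau))).

(* With w = [offset tau], the coefficients of the values of [f] at
   x^{c_1}, ..., x^{c_p} on x^{w + c_1 + ... + c_p}, divided by [qfactor]. *)
Definition component (tau : expo) (f : seq A -> A) (r : seq cell) : W :=
  [ffun t => if cexp t + tot r == tau then (qfactor (offset tau) r)^-1 * coords (f (mons r)) t
    else 0].

Lemma ext_component tau f r t : ext t (component tau f r) =
  if t + tot r == tau then (qfactor (offset tau) r)^-1 * ext t (coords (f (mons r))) else 0.
Proof.
case: (boolP (box m t)) => [/box_cell[u ->]|nb]; first by rewrite !ext_cexp ffunE.
by rewrite !ext_out // mulr0; case: ifP.
Qed.

Lemma component_gr tau f r : tw_grading (lam := lam (offset tau)) tau (tot r) (component tau f r).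
Proof. by move=> t /negPf ne; rewrite ext_component ne. Qed.

Lemma delta_component tau G p s : multilinear p G -> size s = p.+1 ->
  delta (V := Mt tau) (component tau G) s = component tau (hdiff G) s.
Proof.
move=> ml ss; apply: ext_inj => t _; rewrite ext_component.
case: eqP => [e|/eqP ne]; last first.
  have H : tw_grading (lam := lam (offset tau)) tau (tot s) (delta (V := Mt tau) (component tau
    G) s).
    by apply: delta_gr => [|r]; [exact: tw_graded|exact: component_gr].
  exact: H.
rewrite (coords_hdiff (h := component tau G) (w := offset tau) ml erefl _ ss e).
  by rewrite mulKf // qfactor_neq0.
by move=> r u _ er; rewrite ext_component er eqxx mulVKf // qfactor_neq0.
Qed.

Lemma component_cocycle tau p f : cocycle p f ->
  forall s, size s = p.+1 -> delta (V := Mt tau) (component tau f) s = 0.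
Proof.
move=> [ml cf] s ss; rewrite (delta_component _ ml ss); apply: ext_inj => t _.
by rewrite ext_component cf ?size_map // raddf0 ext0 mulr0; case: ifP.
Qed.

(** Only finitely many tau matter for p + 1 arguments, so primitives can be chosen for all of them
    and assembled coordinate by coordinate. *)
Lemma component_glue p f : multilinear p.+1 f ->
  (forall tau, bar_cobound p.+1 (V := Mt tau) (component tau f)) ->
  exists h, multilinear p h /\ forall s, size s = p.+1 -> f s = hdiff h s.
Proof.
(* Each entry of t + tot s, with p + 1 factors in s, is a sum of p + 2 exponents, each bounded by
   the sum of the m_i. *)
move=> ml cob; pose B := (p.+2 * \sum_i m i)%N.
pose emb (c : {ffun 'I_n -> 'I_B.+1}) : expo := [ffun i => nat_of_ord (c i)].
have [H HP] : exists H : {ffun 'I_n -> 'I_B.+1} -> seq cell -> W, forall c s,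
    size s = p.+1 -> component (emb c) f s = delta (V := Mt (emb c)) (H c) s.
  apply: (@fin_all_exists _ (fun=> seq cell -> W) (fun c h => forall s,
    size s = p.+1 -> component (emb c) f s = delta (V := Mt (emb c)) h s)) => c.
  exact: (cob (emb c)).
pose bmb (c : expo) : {ffun 'I_n -> 'I_B.+1} := [ffun i => inord (c i)].
(* The coordinate t of the value on r uses the primitive for tau = t + tot r, the only component
   that it can belong to. *)
pose val_ (r : seq cell) : A := \sum_t (qfactor (offset (cexp t + tot r)) r *
  H (bmb (cexp t + tot r)) r t) *: mon (cexp (compl t)).
have vecval r u : ext u (coords (val_ r)) = qfactor (offset (u + tot r)) r * ext u (H (bmb (u +
  tot r)) r).
  case: (boolP (box m u)) => [/box_cell[t ->]|nb]; last by rewrite !ext_out ?mulr0.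
  rewrite raddf_sum /= ext_sum (bigD1 t) //= coordsZ ext_scl ext_coords_mon complK eqxx mulr1.
  rewrite ext_cexp big1 ?addr0 // => c ct.
  rewrite coordsZ ext_scl ext_coords_mon -(complK c); case: eqP; rewrite ?mulr0 // addrC
    [RHS]addrC.
  by move=> /addE_injl /cexp_inj e; rewrite e eqxx in ct.
exists (multiext val_); split; first exact: multilinear_multiext.
apply: multilinear_ext => //; first by apply: multilinear_hdiff; apply: multilinear_multiext.
move=> s ss; apply: coords_inj; apply: ext_inj => t bt.
set tau := t + tot s.
have tauB i : (tau i <= B)%N.
  have mB : (m i <= \sum_i m i)%N by rewrite (bigD1 i) //= leq_addr.
  have totB (r : seq cell) : (tot r i <= size r * \sum_i m i)%N.
    elim: r => [|c r IH]; first by rewrite tot_nil zeroEE.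
    rewrite tot_cons addEE /= mulSn leq_add //; apply: leq_trans mB.
    by rewrite ffunE ltnW.
  rewrite /tau addEE /B mulSn -ss leq_add // (leq_trans _ mB) // ltnW //.
  exact: (boxP _ _ bt).
have embK : emb (bmb tau) = tau by apply/ffunP=> i; rewrite ffunE [bmb _ _]ffunE inordK ?ltnS.
rewrite (coords_hdiff (tau := tau) (w := offset tau) (h := H (bmb tau)) (p := p)) //; first last.
- by move=> r u _ e; rewrite multiext_mons vecval e.
- exact: multilinear_multiext.
have := HP (bmb tau) s ss; rewrite embK => <-.
by rewrite ext_component eqxx mulVKf // qfactor_neq0.
Qed.

(** * Consequences of freeness *)

Lemma theta_ratio u w : theta u w / theta w u =
  \prod_(i < n) \prod_(j < n | (i < j)%N) q i j ^ (u j * w i - w j * u i).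
Proof.
rewrite /theta -prodf_div; apply: eq_bigr => i _; rewrite -prodf_div.
by apply: eq_bigr => j ij; rewrite expfzDr ?q0 // invr_expz.
Qed.

Hypothesis qfree : free_abelian_gens q.
Hypothesis n2 : (1 < n)%N.

(** In the power lam_i^N the generator q of the pair {i, j} has exponent N w_j up to sign, which is
    nonzero; freeness then forbids the value 1. *)
Lemma lam_exp_neq1 (w : @zexpo n) i j N : i != j -> w j != 0 -> (0 < N)%N -> lam w i ^+ N != 1.
Proof.
move=> ij wj N0; rewrite -chi_unit chi_lam theta_ratio; apply: contraNneq wj => /qfree.2 e.
have NZ : N%:Z != 0 by rewrite -lt0n in N0 *; case: N N0 {e}.
have ji : j != i by rewrite eq_sym.
have /orP[lt|lt] : (i < j)%N || (j < i)%N by rewrite -neq_ltn.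
  have := e _ _ lt; rewrite !ffunE eqxx (negPf ji) mul0r sub0r.
  by move/eqP; rewrite oppr_eq0 mulf_eq0 (negPf NZ) orbF.
have := e _ _ lt; rewrite !ffunE eqxx (negPf ji) mulr0 subr0.
by move/eqP; rewrite mulf_eq0 (negPf NZ).
Qed.

Lemma step_coef_neq0 (w : @zexpo n) i j b : i != j -> w j != 0 -> step_coef m (lam w) i b != 0.
Proof.
move=> ij wj; case: b; rewrite /step_coef.
  by rewrite subr_eq0 -[lam w i]expr1 (lam_exp_neq1 ij).
(* The geometric sum times lam_i - 1 is lam_i^(m_i) - 1, which is nonzero. *)
apply: contraNneq (lam_exp_neq1 ij wj (m0 i)) => s0.
by rewrite -subr_eq0 subrX1 s0 mulr0.
Qed.

Lemma top_neq0 : top != 0.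
Proof.
apply/eqP=> /ffunP/(_ (Ordinal (ltnW n2))); rewrite ffunE zeroEE => e.
by have := m2 (Ordinal (ltnW n2)); lia.
Qed.

(** If tau_i is nonzero and differs from top_i for the same i, any second direction l resolves the
    conflict: a nonzero tau_l makes l usable, and tau_l = 0 differs from top_l. *)
Lemma generic_direction tau : tau != top -> tau != 0 ->
  exists i j, [/\ i != j, tau i != 0%N & offset tau j != 0].
Proof.
move=> ntop n0; have [i0 ti] := expo_eq0P n0.
have dE j : (offset tau j != 0) = (tau j != top j).
  by rewrite /offset !ffunE subr_eq0 eq_sym.
have [j0 tj] : exists j, tau j != top j.
  apply/existsP; apply: contraNT ntop => /existsPn e; apply/eqP/ffunP=> j.
  by apply/eqP; rewrite -[_ == _]negbK e.
case: (eqVneq i0 j0) => [e|ij]; last by exists i0, j0; rewrite dE.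
subst j0; have [l li] : exists l, l != i0.
  have [e|ne] := eqVneq i0 (Ordinal (ltnW n2)); last by exists (Ordinal (ltnW n2)); rewrite
    eq_sym.
  by exists (Ordinal n2); rewrite e.
case: (eqVneq (tau l) 0%N) => tl; last by exists l, i0; rewrite dE.
exists i0, l; rewrite dE tl eq_sym; split=> //.
by rewrite eq_sym ffunE; have := m2 l; lia.
Qed.

Lemma component_cobound tau p f : tau != top -> (tau != 0) || (p != 0%N) -> cocycle p f ->
  bar_cobound p (V := Mt tau) (component tau f).
Proof.
move=> ntop np cf; have cc := component_cocycle tau cf.
case: (eqVneq tau 0) np => [e|n0 _]; last first.
  have [i [j [ij ti dj]]] := generic_direction ntop n0.
  apply: (tw_acyclic m2 (tau := tau) (i := i)) => //.
    by move=> b; apply: (step_coef_neq0 _ ij).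
  by move=> s; apply: component_gr.
case: p cf cc => // p cf cc _; apply: tw_socle => // s.
by move=> t ne; have H := @component_gr tau f s; apply: H; rewrite e.
Qed.

(** * The cocycles U and V_i *)

Definition diag (h : expo -> k) (a : A) : A := \sum_t (h (cexp t) * coef t a) *: mon (cexp t).

Lemma diag_lin h c a b : diag h (c *: a + b) = c *: diag h a + diag h b.
Proof.
rewrite /diag scaler_sumr -big_split; apply: eq_bigr => t _ /=.
by rewrite coef_lin mulrDr scalerDl scalerA mulrCA.
Qed.

Lemma diag_mon h c : diag h (mon c) = h c *: mon c.
Proof.
case: (boolP (box m c)) => [/box_cell[t ->]|nb].
  rewrite /diag (bigD1 t) //= coef_mon eqxx mulr1 big1 ?addr0 // => u ut.
  by rewrite coef_mon (inj_eq (@cexp_inj _ _)) (negPf ut) mulr0 scale0r.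
rewrite (mon_out rel) // scaler0 /diag big1 // => t _.
by rewrite coef0 mulr0 scale0r.
Qed.

Definition dcoch (h : expo -> k) (s : seq A) : A := diag h (head 0 s).

Lemma multilinear_dcoch h : multilinear 1 (dcoch h).
Proof. by move=> [|? ?] [|? ?] // a b c _; apply: diag_lin. Qed.

Lemma diagZ h (c : k) a : diag h (c *: a) = c *: diag h a.
Proof.
have d0 : diag h 0 = 0 by rewrite /diag big1 // => t _; rewrite coef0 mulr0 scale0r.
by rewrite -[c *: a]addr0 diag_lin d0 addr0.
Qed.

(** Also valid when c + c' leaves the box, since the product is then 0. It shows that an additive h
    gives a derivation, and it later provides primitives for the exterior relations. *)
Lemma hdiff_dcoch h c c' : hdiff (dcoch h) [:: mon c; mon c'] =
  (h c' - h (c + c') + h c) *: (mon c * mon c').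
Proof.
rewrite hdiff_cons hdiff_tail2 hdiff_tail1 /dcoch /= !diag_mon (mon_mul rel) diagZ diag_mon.
rewrite -scalerAr -scalerAl (mon_mul rel) !scalerA opprB addrA.
rewrite -scalerDl -scalerBl; congr (_ *: _); ring.
Qed.

(** The Euler derivation x_i d/dx_i. *)
Definition vgen (i : 'I_n) : seq A -> A := dcoch (fun c => (c i)%:R).
Definition ugen : seq A -> A := fun=> mon top.

Lemma cocycle_vgen i : cocycle 1 (vgen i).
Proof.
split; first exact: multilinear_dcoch.
apply: (multilinear_ext (g := fun=> 0)).
- by apply: multilinear_hdiff; apply: multilinear_dcoch.
- by move=> s t a b c _; rewrite scaler0 addr0.
move=> [|c [|c' [|? ?]]] // _; rewrite [LHS]hdiff_dcoch addEE natrD.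
by rewrite opprD addrCA subrr addr0 addNr scale0r.
Qed.

Lemma mon_top_mul c : c != 0 -> mon c * mon top = 0 /\ mon top * mon c = 0.
Proof.
move=> c0; have nb : ~~ box m (top + c).
  have [i ci] := expo_eq0P c0; apply/boxP=> /(_ i); rewrite addEE ffunE.
  by have := m0 i; move: ci; lia.
by split; rewrite (mon_mul rel) (mon_out rel) ?scaler0 // addrC.
Qed.

Lemma mon_top_central c : mon c * mon top = mon top * mon c.
Proof.
case: (eqVneq c 0) => [->|/mon_top_mul[-> ->] //].
by rewrite mon0 mul1r mulr1.
Qed.

Lemma cocycle_ugen : cocycle 0 ugen.
Proof.
split=> [s t a b c //|]; apply: (multilinear_ext (g := fun=> 0)).
- by apply: multilinear_hdiff => s t.
- by move=> s t a b c _; rewrite scaler0 addr0.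
move=> [|c [|? ?]] // _.
by rewrite /= hdiff_cons hdiff_tail1 mon_top_central subrr.
Qed.

Lemma cocycle_cst1 : cocycle 0 (@cst1 k A).
Proof.
split=> [s t a b c //|[|a [|? ?]] // _].
by rewrite hdiff_cons hdiff_tail1 mulr1 mul1r subrr.
Qed.

Lemma cocycle_vprod l : cocycle (size l) (vprod vgen l).
Proof.
elim: l => [|i l IH]; first exact: cocycle_cst1.
by apply: cocycle_cup1; [apply: cocycle_vgen|].
Qed.

(** The quantum scalar is exactly [qfactor 0], so the component at [top] strips it and leaves the
    commutative cochain [wcoch]. *)
Lemma vprod_mons l s : size s = size l ->
  vprod vgen l (mons s) = (wprod k l s * qfactor 0 s) *: mon (tot s).
Proof.
elim: l s => [|i l IH] [|c s] //= => [_|[ss]].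
  by rewrite tot_nil mon0 mulr1 scale1r.
rewrite /cup /= take0 drop0 /vgen /dcoch /= diag_mon IH //.
rewrite -scalerAr -scalerAl (mon_mul rel) !scalerA tot_cons theta0l mul1r [0 + _]addrC
  qfactor_add.
by congr (_ *: _); ring.
Qed.

(** * The basis of HH *)

Local Notation combo := (hh_combo ugen vgen).
Local Notation M := (tw m [ffun=> 1]).

Lemma lam0 : lam (offset top) = [ffun=> 1].
Proof. by apply/ffunP=> i; rewrite !ffunE /offset subrr theta0l theta0r divr1. Qed.

Lemma cocycle_combo p c b : cocycle p (combo p c b).
Proof.
have cs : cocycle p (fun s => \sum_(S : {set 'I_n} | #|S| == p) c S *: vprod vgen (enum S) s).
  by apply: cocycle_sum => S /eqP <-; rewrite cardE; apply: cocycle_vprod.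
have cu : cocycle p (fun s => if p == 0%N then b *: ugen s else 0).
  case: p {cs} => [|p]; last exact: cocycle_zero.
  apply: cocycle_ext (cocycle_lin b cocycle_ugen (cocycle_zero A 0)) => s.
  by rewrite addr0.
by apply: cocycle_ext (cocycle_lin 1 cs cu) => s; rewrite scale1r.
Qed.

Lemma ext_coords_combo p c b r t : size r = p ->
  ext t (coords (combo p c b (mons r))) =
  (\sum_(S : {set 'I_n} | #|S| == p) c S * wprod k (enum S) r) * qfactor 0 r * (t + tot r ==
    top)%:R
  + (if p == 0%N then b * (t == 0)%:R else 0).
Proof.
move=> rp; rewrite /hh_combo coordsD extD; congr (_ + _); last first.
  case: eqP => _; rewrite ?raddf0 ?ext0 // coordsZ ext_scl ext_coords_mon; congr (_ * _%:R).
  congr nat_of_bool; apply/eqP/eqP => [|->]; last by rewrite add0r.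
  by rewrite -{2}[top]add0r addrC [RHS]addrC => /addE_injl.
rewrite raddf_sum /= ext_sum !mulr_suml; apply: eq_bigr => S /eqP Sp.
rewrite coordsZ vprod_mons; last by rewrite rp -Sp cardE.
by rewrite coordsZ !ext_scl ext_coords_mon !mulrA.
Qed.

Definition wsum p (c : {set 'I_n} -> k) (r : seq cell) : M :=
  \sum_(S : {set 'I_n} | #|S| == p) scl (c S) (wcoch k (enum S) 0 r).

Lemma component_combo_top p c b r : size r = p -> component top (combo p c b) r = wsum p c r.
Proof.
move=> rp; apply: ext_inj => t _; rewrite ext_component ext_coords_combo // /wsum ext_sum.
have -> : offset top = 0 by rewrite /offset subrr.
rewrite [RHS](eq_bigr (fun S : {set 'I_n} =>
  c S * (if t + tot r == top then wprod k (enum S) r else 0))); last first.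
  by move=> S _; rewrite ext_scl ext_wcoch // addr0.
case: eqP => [e|_]; last by rewrite big1 // => S _; rewrite mulr0.
rewrite mulr1 [if p == 0%N then _ else _](_ : _ = 0) ?addr0.
  by rewrite mulrC mulfK // qfactor_neq0.
case: eqP => // p0; case: eqP => [t0|_]; last by rewrite mulr0.
move: e top_neq0; rewrite t0 add0r; case: (r) rp => [|? ?] rp.
  by rewrite tot_nil => <-; rewrite eqxx.
by rewrite p0 in rp.
Qed.

Lemma phi_wsum p c (S : {set 'I_n}) : #|S| = p ->
  ext (cotop m S) (phi p (wsum p c) (ind S)) = c S.
Proof.
move=> Sp; rewrite phi_sum ext_sum (bigD1 S) ?Sp //= big1 ?addr0 => [|S' /andP[/eqP S'p ne]];
  rewrite (@phi_nat _ _ _ M M (@scl n m k (c _))) ?ext_scl;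
  try by move=> c0 v; apply: ext_inj => t _; rewrite /= !(ext_scl, ext_shiftI).
  by rewrite -[in phi p _]Sp phi_wcoch_ind // eqxx mulr1.
by rewrite -[in phi p _]S'p phi_wcoch_ind // (negPf ne) mulr0.
Qed.

Lemma hh_span p f : cocycle p f -> exists c b, cohomologous p f (combo p c b).
Proof.
(* The candidate coefficients are the values of the dual functionals on the component at [top]; b
   below is the coefficient of x^top. *)
move=> cf; pose c S := ext (cotop m S) (phi (V := M) p (component top f) (ind S)).
pose b := ext 0 (coords (f [::])); exists c, b.
pose g s := (-1) *: combo p c b s + f s.
have cg : cocycle p g by apply: cocycle_lin => //; apply: cocycle_combo.
have compB tau r : component tau g r = component tau f r - component tau (combo p c b) r.
  apply: ext_inj => t _; rewrite extB !ext_component; case: eqP => _; last by rewrite subr0.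
  by rewrite /g coordsD extD coordsZ ext_scl; ring.
have cob tau : bar_cobound p (V := Mt tau) (component tau g).
  case: (eqVneq tau top) => [->|ntop].
    have cc := component_cocycle top cg; rewrite lam0 in cc *.
    apply: tw_top => // [s|S Sp].
      by have H := @component_gr top g s; move=> t ne; apply: H.
    rewrite (phi_eq (g := fun r => (component top f r : M) - wsum p c r)).
      by rewrite phiB extB phi_wsum // subrr.
    by move=> r rp; rewrite compB component_combo_top.
  case: (boolP ((tau != 0) || (p != 0%N))); first by move=> ?; apply: component_cobound.
  (* The exceptional case is the multidegree of U in degree 0, where b was chosen to cancel the only
     coordinate. *)
  rewrite negb_or !negbK => /andP[/eqP t0 /eqP p0].
  move: compB; rewrite /bar_cobound p0 => compB.
  rewrite compB; apply: ext_inj => t _; rewrite ext0 extB !ext_component tot_nil addr0 t0.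
  case: eqP => [->|_]; last by rewrite subr0.
  rewrite -mulrBr (ext_coords_combo _ _ _ (r := [::])) // tot_nil addr0 eq_sym.
  by rewrite (negPf top_neq0) mulr0 add0r eqxx mulr1 subrr mulr0.
have fg s : f s - combo p c b s = g s by rewrite /g scaleN1r addrC.
case: p @c @g cg compB cob fg cf => [|p] c g cg compB cob fg cf.
  (* Degree 0 has no coboundaries, so g itself must vanish; with no arguments the component at tau =
     t is the coordinate t up to a nonzero scalar. *)
  apply/eqP; rewrite -subr_eq0 fg; apply/eqP/coords_inj/ext_inj => t bt; rewrite raddf0 ext0.
  have := cob t => /(congr1 (ext t)); rewrite ext_component tot_nil addr0 eqxx ext0.
  by move/eqP; rewrite mulf_eq0 invr_eq0 (negPf (qfactor_neq0 _ _)) => /eqP.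
have [h [mh gh]] := component_glue cg.1 cob.
by exists h; split=> // s ss; rewrite fg gh.
Qed.

(** In positive degree the functional for S returns c S on the combination and 0 on coboundaries. In
    degree 0 the coefficients of 1 and x^top are compared directly. *)
Lemma hh_indep p c b : cohomologous p (combo p c b) (@czero k A) ->
  (p = 0%N -> b = 0) /\ forall S : {set 'I_n}, #|S| = p -> c S = 0.
Proof.
case: p => [|p] /=.
  move=> e; have E t : ext t (coords (combo 0 c b (mons [::]))) = 0 by rewrite e raddf0 ext0.
  have b0 : b = 0.
    have := E 0; rewrite ext_coords_combo // tot_nil addr0 eq_sym (negPf top_neq0) mulr0 add0r.
    by rewrite eqxx mulr1.
  split=> // S /eqP; rewrite cards_eq0 => /eqP ->.
  have := E top; rewrite ext_coords_combo // tot_nil addr0 eqxx b0 mul0r addr0 !mulr1.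
  rewrite (bigD1 set0) ?cards0 //= big1 ?addr0 => [|S' /andP[]]; last first.
    by rewrite cards_eq0 => ->.
  by rewrite enum_set0 mulr1.
move=> [h [mh e]]; split=> // S Sp; rewrite -(phi_wsum c Sp).
have -> : phi p.+1 (wsum p.+1 c) (ind S) = phi (V := M) p.+1 (delta (component top h : seq cell
  -> M)) (ind S).
  apply: phi_eq => r rp; rewrite -(component_combo_top c b) // -lam0 (delta_component top mh) //.
  apply: ext_inj => t _; rewrite !ext_component -e ?size_map //.
  by rewrite /czero subr0.
by rewrite phi_delta_ind // ext0.
Qed.
End Untwist.

(** * Relations and brackets *)

Lemma bin2_add a b : 'C(a + b, 2) = ('C(a, 2) + 'C(b, 2) + a * b)%N.
Proof.
elim: a => [|a IH]; first by rewrite bin0n !add0n addn0.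
by rewrite addSn !binS !bin1 IH mulSn; lia.
Qed.

Theorem theorem6p3 (k : fieldType) (n : nat) (m : 'I_n -> nat)
  (q : 'I_n -> 'I_n -> k) (A : algType k) (x : 'I_n -> A) :
  (2 <= n)%N -> (forall i, 2 <= m i)%N ->
  free_abelian_gens q ->
  is_qci_presentation m q x ->
  exists (u : seq A -> A) (v : 'I_n -> seq A -> A),
    [/\
     (* U in degree 0, V_i in degree 1 are Hochschild cocycles *)
     cocycle 0 u /\ (forall i, cocycle 1 (v i)),
     (* the classes of 1, U, V_S form a basis of HH^*(A) *)
     (forall p f, cocycle p f ->
        exists c b, cohomologous p f (hh_combo u v p c b)) /\
     (forall p c b, cohomologous p (hh_combo u v p c b) (@czero k A) ->
        (p = 0%N -> b = 0) /\ forall S : {set 'I_n}, #|S| = p -> c S = 0),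
     (* multiplicative relations: U^2 = 0, U V_i = V_i U = 0, exterior *)
     [/\ cohomologous 0 (cup 0 u u) (@czero k A),
         forall i, cohomologous 1 (cup 0 u (v i)) (@czero k A),
         forall i, cohomologous 1 (cup 1 (v i) u) (@czero k A),
         forall i, cohomologous 2 (cup 1 (v i) (v i)) (@czero k A) &
         forall i j, cohomologous 2
           (fun s => cup 1 (v i) (v j) s + cup 1 (v j) (v i) s) (@czero k A)] &
     (* Gerstenhaber brackets *)
     (forall i, cohomologous 0 (gbracket 1 0 (v i) u)
                               (fun s => (m i).-1%:R * u s)) /\
     (forall i j, cohomologous 1 (gbracket 1 1 (v i) (v j)) (@czero k A))].
Proof.
move=> n2 m2 qfree pres; have [rel _ _] := pres.
have q0 := qfree.1.
have [coef [clin cmon csum]] := monomial_basis (fun i => ltnW (m2 i)) q0 pres.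
pose u := @ugen k n m A x; pose v := @vgen k n m A x coef.
have ext1 (f : seq A -> A) : multilinear 1 f -> (forall c, f [:: mon x (@cexp n m c)] = 0) ->
    forall s, size s = 1%N -> f s = 0.
  move=> mf f0; apply: (multilinear_ext csum mf (g := fun=> 0)).
    by move=> s t a b c _; rewrite scaler0 addr0.
  by move=> [|c [|? ?]] // _; apply: f0.
have dm := diag_mon rel clin cmon; have dl := diag_lin x clin; have dz := diagZ x clin.
have v1 i c : v i [:: mon x c] = (c i)%:R *: mon x c by apply: dm.
have cv i : cocycle 1 (v i) by apply: (cocycle_vgen rel).
have ml0 : multilinear 0 (fun=> 0 : A) by move=> s t.
have h0 (f : seq A -> A) : (forall s, size s = 1%N -> f s = 0) -> cohomologous 1 f (@czero k A).
  move=> f0; exists (fun=> 0); split=> // -[|a [|? ?]] // _.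
  by rewrite f0 // hdiff_cons hdiff_tail1 mulr0 mul0r.
have cup2 h (f : seq A -> A) : multilinear 2 f -> (forall c c',
    f [:: mon x (@cexp n m c); mon x (@cexp n m c')] =
    (h (cexp c') - h (cexp c + cexp c') + h (cexp c)) *: (mon x (cexp c) * mon x (cexp c'))) ->
    cohomologous 2 f (@czero k A).
  move=> mf fh; exists (dcoch x coef h); split; first by apply: multilinear_dcoch.
  move=> s ss; rewrite /czero subr0; apply: (multilinear_ext csum mf) ss.
    by apply: multilinear_hdiff; apply: multilinear_dcoch.
  move=> [|c [|c' [|? ?]]] // _; by rewrite [LHS]fh [RHS](hdiff_dcoch rel clin cmon).
have mlcup i j : multilinear 2 (cup 1 (v i) (v j)).
  by have [] := cocycle_cup1 (cv i) (cv j).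
exists u, v; split.
- by split=> //; apply: (cocycle_ugen m2 rel csum n2).
- split=> p f; first exact: (hh_span m2 q0 rel clin cmon csum qfree n2).
  exact: (hh_indep m2 q0 rel clin cmon csum n2).
- split=> [|i|i|i|i j].
  + by rewrite /= /cup; apply: (mon_top_mul m2 rel n2 (top_neq0 m2 n2)).1.
  + apply: h0; apply: ext1 => [|c].
      by move=> [|? ?] [|? ?] // a b c _; rewrite /cup /v /vgen /dcoch /= dl mulrDr -scalerAr.
    rewrite /cup /= v1 -scalerAr; case: (eqVneq (cexp c) 0) => [->|c0].
      by rewrite zeroEE scale0r.
    by rewrite (mon_top_mul m2 rel n2 c0).2 scaler0.
  + apply: h0; apply: ext1 => [|c].
      by move=> [|? ?] [|? ?] // a b c _; rewrite /cup /v /vgen /dcoch /= dl mulrDl -scalerAl.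
    rewrite /cup /= v1 -scalerAl; case: (eqVneq (cexp c) 0) => [->|c0].
      by rewrite zeroEE scale0r.
    by rewrite (mon_top_mul m2 rel n2 c0).1 scaler0.
  (* The binomial coefficient polarizes to c_i c'_i without dividing by 2, so V_i^2 bounds in
     characteristic 2 as well. *)
  + apply: (cup2 (fun c => - 'C(c i, 2)%:R)) => // c c'.
    rewrite /cup /= !v1 -scalerAl -scalerAr scalerA; congr (_ *: _).
    by rewrite addEE opprK bin2_add !natrD natrM; ring.
  (* The quadratic form c_i c_j has polarization c_i c'_j + c_j c'_i, the value of the
     anticommutator. *)
  apply: (cup2 (fun c => - (c i * c j)%:R)) => [s t a b c e|c c'].
    by rewrite !mlcup // scalerDr addrACA.
  rewrite /cup /= !v1 -!scalerAl -!scalerAr !scalerA -scalerDl; congr (_ *: _).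
  by rewrite !addEE !natrM !natrD; ring.
split=> [i|i j].
  (* A 0-cochain has no slot, so one circle product is empty; the other applies V_i to x^top, an
     eigenvector of eigenvalue m_i - 1. *)
  rewrite /= /gbracket /gcirc big_ord1 big_ord0 /= mulr0 subr0 mul0n expr0 mul1r.
  by rewrite v1 mulr_natl -scaler_nat ffunE.
apply: h0 => s ss; rewrite /gbracket /gcirc !big_ord1 mul0n expr0 !mul1r /=.
rewrite exprM sqrrN !expr1n mul1r; move: s ss.
apply: ext1 => [|c].
  move=> [|? ?] [|? ?] // a b c _; rewrite /v /vgen /dcoch /= !dl.
  by rewrite scalerBr opprD addrACA.
(* Both derivations are diagonal on monomials, so they commute on the nose. *)
rewrite /= !v1 /v /vgen /dcoch /= !dz !dm !scalerA mulrC subrr.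
by [].
Qed.
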